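(* Let $k$ be a field of characteristic $0$ and let $\Theta$ be the variety of all commutative (not necessarily associative) linear algebras over $k$. Let $\mathfrak{A}$ be the group of all automorphisms of the category $\Theta^0$ of finitely generated free algebras of $\Theta$, and let $\mathfrak{Y}$ be the normal subgroup of all inner automorphisms. Then $$\mathfrak{A}/\mathfrak{Y}\;\cong\; \mathrm{Aut}\,k ,$$ where $\mathrm{Aut}\,k$ is the group of all field automorphisms of $k$.
   Context: A linear algebra over $k$ is a $k$-vector space with a $k$-bilinear multiplication (not assumed associative, commutative or unital). It is regarded as a one-sorted universal algebra with operations $0$, $+$, $\cdot$, and one unary operation $h\mapsto\lambda h$ for each $\lambda\in k$; homomorphisms are $k$-linear multiplicative maps. The variety of all commutative algebras is defined by the single identity $x_1x_2=x_2x_1$. Fix a countable set $X_0=\{x_1,x_2,\ldots\}$. The category $\Theta^0$ has as objects the free algebras $F(X)$ of $\Theta$ generated by finite subsets $X\subset X_0$, and as morphisms all homomorphisms between them. An automorphism of a category $\mathfrak{K}$ is an invertible functor $\mathfrak{K}\to\mathfrak{K}$; an automorphism $\Upsilon$ is inner if it is isomorphic as a functor to the identity functor, i.e. for each object $A$ there is an isomorphism $s_A:A\to\Upsilon(A)$ with $\Upsilon(\psi)s_A=s_B\psi$ for every morphism $\psi:A\to B$. *)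

(* Defs.v *)
From HB Require Import structures.
From mathcomp Require Import all_boot all_algebra.
From mathcomp Require Import generic_quotient finmap boolp.

Set Implicit Arguments.
Unset Strict Implicit.
Unset Printing Implicit Defensive.

Import GRing.Theory.

Local Open Scope quotient_scope.
Local Open Scope ring_scope.

(* Linear algebras are not assumed associative, commutative or unital. *)

HB.mixin Record Lmodule_isLinAlgebra (k : fieldType) A of GRing.Lmodule k A := {
  amul : A -> A -> A;
  amulDl : left_distributive amul +%R;
  amulDr : right_distributive amul +%R;
  amulZl : forall (c : k) (x y : A), amul (c *: x) y = c *: amul x y;
  amulZr : forall (c : k) (x y : A), amul x (c *: y) = c *: amul x y
}.

#[short(type="linAlgType")]
HB.structure Definition LinAlgebra (k : fieldType) :=
  {A of Lmodule_isLinAlgebra k A & GRing.Lmodule k A}.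

HB.mixin Record LinAlgebra_isCommutative (k : fieldType) A of LinAlgebra k A := {
  amulC : commutative (@amul k A)
}.

#[short(type="comLinAlgType")]
HB.structure Definition ComLinAlgebra (k : fieldType) :=
  {A of LinAlgebra_isCommutative k A & LinAlgebra k A}.

Record alg_hom (k : fieldType) (A B : linAlgType k) := AlgHom {
  alg_fun :> A -> B;
  alg_fun_linear : linear alg_fun;
  alg_funM : {morph alg_fun : x y / amul x y}
}.

HB.instance Definition _ (k : fieldType) (A B : linAlgType k)
    (f : alg_hom A B) :=
  GRing.isLinear.Build k A B *:%R (alg_fun f) (alg_fun_linear f).

Lemma alg_hom_ext (k : fieldType) (A B : linAlgType k) (f g : alg_hom A B) :
  f =1 g -> f = g.
Proof.
case: f g => [f f1 f2] [g g1 g2] /= /funext fg; move: f1 f2; rewrite fg => *.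
by congr AlgHom; exact: Prop_irrelevance.
Qed.

Definition alg_id (k : fieldType) (A : linAlgType k) : alg_hom A A :=
  @AlgHom k A A id (fun _ _ _ => erefl) (fun _ _ => erefl).

Section AlgComp.
Variables (k : fieldType) (A B C : linAlgType k).
Variables (g : alg_hom B C) (f : alg_hom A B).

Fact alg_comp_linear : linear (g \o f).
Proof. by move=> a x y /=; rewrite !linearP. Qed.

Fact alg_compM : {morph g \o f : x y / amul x y}.
Proof. by move=> x y /=; rewrite !alg_funM. Qed.

Definition alg_comp : alg_hom A C := AlgHom alg_comp_linear alg_compM.

End AlgComp.

Inductive term (k : Type) (X : Type) :=
| TVar of X
| TZero
| TAdd of term k X & term k X
| TMul of term k X & term k X
| TScale of k & term k X.

Arguments TVar {k X}.
Arguments TZero {k X}.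

HB.instance Definition _ (k X : Type) := gen_eqMixin (term k X).
HB.instance Definition _ (k X : Type) := gen_choiceMixin (term k X).

(* The least congruence on terms containing all instances of the axioms of
   k-vector spaces, of bilinearity, and of x1 x2 = x2 x1.  The opposite of t
   is TScale (-1) t. *)
Inductive com_equiv (k : fieldType) (X : Type) : term k X -> term k X -> Prop :=
| ce_refl s : com_equiv s s
| ce_sym s t : com_equiv s t -> com_equiv t s
| ce_trans s t u : com_equiv s t -> com_equiv t u -> com_equiv s u
| ce_add s s' t t' : com_equiv s s' -> com_equiv t t' ->
    com_equiv (TAdd s t) (TAdd s' t')
| ce_mul s s' t t' : com_equiv s s' -> com_equiv t t' ->
    com_equiv (TMul s t) (TMul s' t')
| ce_scale c s s' : com_equiv s s' -> com_equiv (TScale c s) (TScale c s')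
| ce_addA s t u : com_equiv (TAdd s (TAdd t u)) (TAdd (TAdd s t) u)
| ce_addC s t : com_equiv (TAdd s t) (TAdd t s)
| ce_add0 s : com_equiv (TAdd TZero s) s
| ce_addN s : com_equiv (TAdd (TScale (-1) s) s) TZero
| ce_scaleA c d s : com_equiv (TScale c (TScale d s)) (TScale (c * d) s)
| ce_scale1 s : com_equiv (TScale 1 s) s
| ce_scaleDr c s t :
    com_equiv (TScale c (TAdd s t)) (TAdd (TScale c s) (TScale c t))
| ce_scaleDl c d s :
    com_equiv (TScale (c + d) s) (TAdd (TScale c s) (TScale d s))
| ce_mulDl s t u : com_equiv (TMul (TAdd s t) u) (TAdd (TMul s u) (TMul t u))
| ce_mulDr s t u : com_equiv (TMul s (TAdd t u)) (TAdd (TMul s t) (TMul s u))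
| ce_mulZl c s t : com_equiv (TMul (TScale c s) t) (TScale c (TMul s t))
| ce_mulZr c s t : com_equiv (TMul s (TScale c t)) (TScale c (TMul s t))
| ce_mulC s t : com_equiv (TMul s t) (TMul t s).

Section FreeAlgebra.
Variables (k : fieldType) (X : Type).
Implicit Types s t : term k X.

Definition com_equivb s t : bool := `[< com_equiv s t >].

Fact com_equivb_equiv : equiv_class_of com_equivb.
Proof.
split=> [s|s t|t s u]; first by apply/asboolP; exact: ce_refl.
  by apply/asboolP/asboolP; exact: ce_sym.
by move=> /asboolP st /asboolP tu; apply/asboolP; exact: ce_trans tu.
Qed.

Canonical com_equivb_equivRel := EquivRelPack com_equivb_equiv.

Definition freeAlg : Type := {eq_quot com_equivb}.
HB.instance Definition _ := Choice.on freeAlg.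
HB.instance Definition _ := EqQuotient.on freeAlg.

Definition fpi (t : term k X) : freeAlg := \pi_freeAlg t.

Lemma fpiP s t : reflect (com_equiv s t) (fpi s == fpi t).
Proof. by rewrite /fpi eqmodE /=; exact: asboolP. Qed.

Lemma fpi_eq s t : com_equiv s t -> fpi s = fpi t.
Proof. by move=> /fpiP/eqP. Qed.

Lemma com_equiv_repr t : com_equiv (repr (fpi t)) t.
Proof. by apply/fpiP; rewrite /fpi reprK. Qed.

Lemma free_ind (P : freeAlg -> Prop) : (forall t, P (fpi t)) -> forall x, P x.
Proof. by move=> Pt x; rewrite -[x]reprK; exact: Pt. Qed.

Definition gen (x : X) : freeAlg := fpi (TVar x).
Definition free_zero : freeAlg := fpi TZero.
Definition free_add (a b : freeAlg) : freeAlg := fpi (TAdd (repr a) (repr b)).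
Definition free_mul (a b : freeAlg) : freeAlg := fpi (TMul (repr a) (repr b)).
Definition free_scale (c : k) (a : freeAlg) : freeAlg := fpi (TScale c (repr a)).
Definition free_opp (a : freeAlg) : freeAlg := free_scale (-1) a.

Lemma fpi_add s t : free_add (fpi s) (fpi t) = fpi (TAdd s t).
Proof. by apply: fpi_eq; apply: ce_add; exact: com_equiv_repr. Qed.

Lemma fpi_mul s t : free_mul (fpi s) (fpi t) = fpi (TMul s t).
Proof. by apply: fpi_eq; apply: ce_mul; exact: com_equiv_repr. Qed.

Lemma fpi_scale c s : free_scale c (fpi s) = fpi (TScale c s).
Proof. by apply: fpi_eq; apply: ce_scale; exact: com_equiv_repr. Qed.

Let fpiE := (fpi_add, fpi_mul, fpi_scale).

Fact free_addA : associative free_add.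
Proof.
elim/free_ind=> s; elim/free_ind=> t; elim/free_ind=> u.
by rewrite !fpiE; apply: fpi_eq; exact: ce_addA.
Qed.

Fact free_addC : commutative free_add.
Proof.
elim/free_ind=> s; elim/free_ind=> t.
by rewrite !fpiE; apply: fpi_eq; exact: ce_addC.
Qed.

Fact free_add0 : left_id free_zero free_add.
Proof. by elim/free_ind=> s; rewrite fpiE; apply: fpi_eq; exact: ce_add0. Qed.

Fact free_addN : left_inverse free_zero free_opp free_add.
Proof.
by elim/free_ind=> s; rewrite /free_opp !fpiE; apply: fpi_eq; exact: ce_addN.
Qed.

HB.instance Definition _ :=
  GRing.isZmodule.Build freeAlg free_addA free_addC free_add0 free_addN.

Fact free_scaleA c d (a : freeAlg) :
  free_scale c (free_scale d a) = free_scale (c * d) a.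
Proof.
by elim/free_ind: a => s; rewrite !fpiE; apply: fpi_eq; exact: ce_scaleA.
Qed.

Fact free_scale1 : left_id 1 free_scale.
Proof. by elim/free_ind=> s; rewrite fpiE; apply: fpi_eq; exact: ce_scale1. Qed.

Fact free_scaleDr : right_distributive free_scale +%R.
Proof.
move=> c; elim/free_ind=> s; elim/free_ind=> t.
by rewrite /+%R /= !fpiE; apply: fpi_eq; exact: ce_scaleDr.
Qed.

Fact free_scaleDl (a : freeAlg) : {morph free_scale^~ a : c d / c + d}.
Proof.
elim/free_ind: a => s c d.
by rewrite [RHS]/+%R /= !fpiE; apply: fpi_eq; exact: ce_scaleDl.
Qed.

HB.instance Definition _ := GRing.Zmodule_isLmodule.Build k freeAlg
  free_scaleA free_scale1 free_scaleDr free_scaleDl.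

Fact free_mulDl : left_distributive free_mul +%R.
Proof.
elim/free_ind=> s; elim/free_ind=> t; elim/free_ind=> u.
by rewrite /+%R /= !fpiE; apply: fpi_eq; exact: ce_mulDl.
Qed.

Fact free_mulDr : right_distributive free_mul +%R.
Proof.
elim/free_ind=> s; elim/free_ind=> t; elim/free_ind=> u.
by rewrite /+%R /= !fpiE; apply: fpi_eq; exact: ce_mulDr.
Qed.

Fact free_mulZl c (a b : freeAlg) : free_mul (c *: a) b = c *: free_mul a b.
Proof.
elim/free_ind: a => s; elim/free_ind: b => t.
by rewrite /*:%R /= !fpiE; apply: fpi_eq; exact: ce_mulZl.
Qed.

Fact free_mulZr c (a b : freeAlg) : free_mul a (c *: b) = c *: free_mul a b.
Proof.
elim/free_ind: a => s; elim/free_ind: b => t.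
by rewrite /*:%R /= !fpiE; apply: fpi_eq; exact: ce_mulZr.
Qed.

HB.instance Definition _ := Lmodule_isLinAlgebra.Build k freeAlg
  free_mulDl free_mulDr free_mulZl free_mulZr.

Fact free_mulC : commutative free_mul.
Proof.
elim/free_ind=> s; elim/free_ind=> t.
by rewrite !fpiE; apply: fpi_eq; exact: ce_mulC.
Qed.

HB.instance Definition _ := LinAlgebra_isCommutative.Build k freeAlg free_mulC.

Section Universal.
Variables (A : comLinAlgType k) (f : X -> A).

Fixpoint eval (t : term k X) : A :=
  match t with
  | TVar x => f x
  | TZero => 0
  | TAdd s t => eval s + eval t
  | TMul s t => amul (eval s) (eval t)
  | TScale c s => c *: eval s
  end.

Lemma eval_equiv s t : com_equiv s t -> eval s = eval t.
Proof.
elim=> {s t} //=.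
- by move=> s t u _ -> _ ->.
- by move=> s s' t t' _ -> _ ->.
- by move=> s s' t t' _ -> _ ->.
- by move=> c s s' _ ->.
- by move=> s t u; rewrite addrA.
- by move=> s t; rewrite addrC.
- by move=> s; rewrite add0r.
- by move=> s; rewrite scaleN1r addNr.
- by move=> c d s; rewrite scalerA.
- by move=> s; rewrite scale1r.
- by move=> c s t; rewrite scalerDr.
- by move=> c d s; rewrite scalerDl.
- by move=> s t u; rewrite amulDl.
- by move=> s t u; rewrite amulDr.
- by move=> c s t; rewrite amulZl.
- by move=> c s t; rewrite amulZr.
- by move=> s t; rewrite amulC.
Qed.

Definition free_eval (a : freeAlg) : A := eval (repr a).

Lemma free_eval_pi t : free_eval (fpi t) = eval t.
Proof. by apply: eval_equiv; exact: com_equiv_repr. Qed.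

Fact free_eval_linear : linear free_eval.
Proof.
move=> c; elim/free_ind=> s; elim/free_ind=> t.
by rewrite [X in free_eval X]/+%R [X in free_eval X]/= /*:%R /=
  !fpiE !free_eval_pi.
Qed.

Fact free_evalM : {morph free_eval : a b / amul a b}.
Proof.
elim/free_ind=> s; elim/free_ind=> t.
by rewrite [X in free_eval X]/amul /= fpiE !free_eval_pi.
Qed.

Definition free_lift : alg_hom freeAlg A := AlgHom free_eval_linear free_evalM.

Theorem free_universal :
  exists! h : alg_hom freeAlg A, forall x, h (gen x) = f x.
Proof.
exists free_lift; split=> [x|h hf]; first exact: free_eval_pi.
apply: alg_hom_ext; elim/free_ind=> t; rewrite /= free_eval_pi.
elim: t => [x||s IHs t IHt|s IHs t IHt|c s IHs] /=.
- by rewrite -hf.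
- by rewrite -[fpi TZero]/(0 : freeAlg) linear0.
- by rewrite IHs IHt -fpi_add -[free_add _ _]/(fpi s + fpi t) linearD.
- by rewrite IHs IHt -fpi_mul -[free_mul _ _]/(amul (fpi s) (fpi t)) alg_funM.
- by rewrite IHs -fpi_scale -[free_scale _ _]/(c *: fpi s) linearZ.
Qed.

End Universal.

End FreeAlgebra.

Record category := Category {
  obj :> Type;
  hom : obj -> obj -> Type;
  idm : forall A, hom A A;
  compm : forall A B C, hom B C -> hom A B -> hom A C;
  compA : forall A B C D (h : hom C D) (g : hom B C) (f : hom A B),
    compm h (compm g f) = compm (compm h g) f;
  comp1m : forall A B (f : hom A B), compm (idm B) f = f;
  compm1 : forall A B (f : hom A B), compm f (idm A) = f
}.

Arguments hom {c}.
Arguments idm {c}.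
Arguments compm {c A B C}.

Definition is_iso (C : category) (A B : C) (f : hom A B) :=
  exists g : hom B A, compm g f = idm A /\ compm f g = idm B.

Record functor (C D : category) := Functor {
  fobj :> C -> D;
  fmap : forall A B, hom A B -> hom (fobj A) (fobj B);
  fmap1 : forall A, fmap (idm A) = idm (fobj A);
  fmapM : forall A B E (g : hom B E) (f : hom A B),
    fmap (compm g f) = compm (fmap g) (fmap f)
}.

Arguments fmap {C D} _ {A B}.

Definition functor_id (C : category) : functor C C :=
  @Functor C C id (fun _ _ f => f) (fun _ => erefl) (fun _ _ _ _ _ => erefl).

Section FunctorComp.
Variables (C D E : category) (G : functor D E) (F : functor C D).

Fact functor_comp1 A : fmap G (fmap F (idm A)) = idm (G (F A)).
Proof. by rewrite !fmap1. Qed.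

Fact functor_compM A B K (g : hom B K) (f : hom A B) :
  fmap G (fmap F (compm g f)) = compm (fmap G (fmap F g)) (fmap G (fmap F f)).
Proof. by rewrite !fmapM. Qed.

Definition functor_comp : functor C E :=
  @Functor C E (G \o F) (fun _ _ f => fmap G (fmap F f))
    functor_comp1 functor_compM.

End FunctorComp.

Definition nat_isomorphic (C D : category) (F G : functor C D) :=
  exists s : forall A, hom (F A) (G A),
    (forall A, is_iso (s A)) /\
    (forall A B (f : hom A B), compm (fmap G f) (s A) = compm (s B) (fmap F f)).

Lemma functor_eq (C D : category) (o : C -> D)
    (m : forall A B : C, hom A B -> hom (o A) (o B)) p1 q1 p2 q2 :
  @Functor C D o m p1 p2 = @Functor C D o m q1 q2.
Proof. by congr Functor; exact: Prop_irrelevance. Qed.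

Lemma functor_compA (C D E K : category)
    (H : functor E K) (G : functor D E) (F : functor C D) :
  functor_comp H (functor_comp G F) = functor_comp (functor_comp H G) F.
Proof. exact: functor_eq. Qed.

Lemma functor_comp1f (C D : category) (F : functor C D) :
  functor_comp (functor_id D) F = F.
Proof. by case: F => o m p1 p2; exact: functor_eq. Qed.

Lemma functor_compf1 (C D : category) (F : functor C D) :
  functor_comp F (functor_id C) = F.
Proof. by case: F => o m p1 p2; exact: functor_eq. Qed.

Lemma nat_isomorphic_refl (C D : category) (F : functor C D) :
  nat_isomorphic F F.
Proof.
exists (fun A => idm (F A)); split=> [A|A B f]; last by rewrite comp1m compm1.
by exists (idm (F A)); rewrite comp1m.
Qed.

Lemma nat_isomorphic_trans (C D : category) (F G H : functor C D) :
  nat_isomorphic F G -> nat_isomorphic G H -> nat_isomorphic F H.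
Proof.
move=> [s [si sn]] [t [ti tn]]; exists (fun A => compm (t A) (s A)).
split=> [A|A B f]; last by rewrite compA tn -compA sn compA.
have [s' [s's ss']] := si A; have [t' [t't tt']] := ti A.
exists (compm s' t'); split.
  by rewrite -compA [compm t' _]compA t't comp1m.
by rewrite -compA [compm (s A) _]compA ss' comp1m.
Qed.

Lemma nat_isomorphic_sym (C D : category) (F G : functor C D) :
  nat_isomorphic F G -> nat_isomorphic G F.
Proof.
move=> [s [si sn]]; pose t A := projT1 (cid (si A)).
have tP A : compm (t A) (s A) = idm _ /\ compm (s A) (t A) = idm _.
  by rewrite /t; case: (cid (si A)).
exists t; split=> [A|A B f]; first by exists (s A); case: (tP A).
have [_ stA] := tP A; have [tsB _] := tP B.
by rewrite -[RHS]compm1 -stA -[RHS]compA [compm _ (compm (s A) _)]compA sn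
  !compA tsB comp1m.
Qed.

Lemma nat_isomorphic_comp (C D E : category) (G G' : functor D E)
    (F F' : functor C D) :
  nat_isomorphic G G' -> nat_isomorphic F F' ->
  nat_isomorphic (functor_comp G F) (functor_comp G' F').
Proof.
move=> GG' FF'; apply: (@nat_isomorphic_trans _ _ _ (functor_comp G F')).
  case: FF' => s [si sn]; exists (fun A => fmap G (s A)).
  split=> [A|A B f] /=; last by rewrite -!fmapM sn.
  by have [t [ts st]] := si A; exists (fmap G t); rewrite -!fmapM ts st !fmap1.
case: GG' => s [si sn]; exists (fun A => s (F' A)).
by split=> [A|A B f] /=; [exact: si | exact: sn].
Qed.

Record cat_aut (C : category) := CatAut {
  aut_functor :> functor C C;
  aut_functorV : functor C C;
  aut_functorK : functor_comp aut_functorV aut_functor = functor_id C;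
  aut_functorVK : functor_comp aut_functor aut_functorV = functor_id C
}.

HB.instance Definition _ (C : category) := gen_eqMixin (cat_aut C).
HB.instance Definition _ (C : category) := gen_choiceMixin (cat_aut C).

Section CatAutGroup.
Variable C : category.
Implicit Types F G H : cat_aut C.

Lemma cat_aut_eq F G : F = G :> functor C C -> F = G.
Proof.
case: F G => [F F' F'F FF'] [G G' G'G GG'] /= FG.
have F'G' : F' = G'.
  by rewrite -[LHS]functor_compf1 -GG' functor_compA -FG F'F functor_comp1f.
move: F'F FF' G'G GG'; rewrite FG F'G' => *.
by congr CatAut; exact: Prop_irrelevance.
Qed.

Definition cat_aut1 : cat_aut C :=
  CatAut (functor_comp1f (functor_id C)) (functor_comp1f (functor_id C)).

Definition cat_autV F : cat_aut C :=
  CatAut (aut_functorVK F) (aut_functorK F).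

Fact cat_autM_subproof (F F' G G' : functor C C) :
  functor_comp F' F = functor_id C -> functor_comp G' G = functor_id C ->
  functor_comp (functor_comp G' F') (functor_comp F G) = functor_id C.
Proof.
move=> F'F G'G.
by rewrite -functor_compA [functor_comp F' _]functor_compA F'F functor_comp1f.
Qed.

Definition cat_autM F G : cat_aut C :=
  CatAut (cat_autM_subproof (aut_functorK F) (aut_functorK G))
         (cat_autM_subproof (aut_functorVK G) (aut_functorVK F)).

Fact cat_autA : associative cat_autM.
Proof. by move=> F G H; apply: cat_aut_eq; exact: functor_compA. Qed.

Fact cat_aut1g : left_id cat_aut1 cat_autM.
Proof. by move=> F; apply: cat_aut_eq; exact: functor_comp1f. Qed.

Fact cat_autg1 : right_id cat_aut1 cat_autM.
Proof. by move=> F; apply: cat_aut_eq; exact: functor_compf1. Qed.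

Fact cat_autVg : left_inverse cat_aut1 cat_autV cat_autM.
Proof. by move=> F; apply: cat_aut_eq; exact: aut_functorK. Qed.

Fact cat_autgV : right_inverse cat_aut1 cat_autV cat_autM.
Proof. by move=> F; apply: cat_aut_eq; exact: aut_functorVK. Qed.

HB.instance Definition _ := isGroup.Build (cat_aut C)
  cat_autA cat_aut1g cat_autg1 cat_autVg cat_autgV.

End CatAutGroup.

Record normal_subgroup (G : groupType) := NormalSubgroup {
  ns_pred :> {pred G};
  ns_group : group_closed ns_pred;
  ns_normal : forall x y : G, y \in ns_pred -> (y ^ x)%g \in ns_pred
}.

Section QuotientGroup.
Local Open Scope group_scope.
Variables (G : groupType) (N : normal_subgroup G).

Definition coset_equiv (x y : G) : bool := x^-1 * y \in ns_pred N.

Let N1 : 1 \in ns_pred N. Proof. by case: (ns_group N). Qed.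
Let NF x y : x \in ns_pred N -> y \in ns_pred N -> x / y \in ns_pred N.
Proof. by case: (ns_group N) => _; exact. Qed.
Let NV x : x \in ns_pred N -> x^-1 \in ns_pred N.
Proof. by move=> Nx; rewrite -[x^-1]mul1g; exact: NF. Qed.
Let NM x y : x \in ns_pred N -> y \in ns_pred N -> x * y \in ns_pred N.
Proof. by move=> Nx Ny; rewrite -[y]invgK; apply: NF => //; exact: NV. Qed.

Fact coset_equiv_equiv : equiv_class_of coset_equiv.
Proof.
rewrite /coset_equiv; split=> [x|x y|y x z]; first by rewrite mulVg.
  by apply/idP/idP=> /NV; rewrite invgM invgK.
by move=> xy yz; have := NM xy yz; rewrite mulgA mulgK.
Qed.

Canonical coset_equivRel := EquivRelPack coset_equiv_equiv.

Definition quotient_group : Type := {eq_quot coset_equiv}.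
HB.instance Definition _ := Choice.on quotient_group.
HB.instance Definition _ := EqQuotient.on quotient_group.

Definition qpi (x : G) : quotient_group := \pi_quotient_group x.

Lemma qpiP x y : (qpi x == qpi y) = (x^-1 * y \in ns_pred N).
Proof. by rewrite /qpi eqmodE. Qed.

Lemma qpi_eq x y : x^-1 * y \in ns_pred N -> qpi x = qpi y.
Proof. by rewrite -qpiP => /eqP. Qed.

Lemma repr_qpi x : (repr (qpi x))^-1 * x \in ns_pred N.
Proof. by rewrite -qpiP /qpi reprK. Qed.

Lemma quotient_ind (P : quotient_group -> Prop) :
  (forall x, P (qpi x)) -> forall a, P a.
Proof. by move=> Px a; rewrite -[a]reprK; exact: Px. Qed.

Definition quotient1 : quotient_group := qpi 1.
Definition quotientM (a b : quotient_group) : quotient_group :=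
  qpi (repr a * repr b).
Definition quotientV (a : quotient_group) : quotient_group := qpi (repr a)^-1.

Lemma qpiM x y : quotientM (qpi x) (qpi y) = qpi (x * y).
Proof.
apply: qpi_eq; have Nx := repr_qpi x; have Ny := repr_qpi y.
have := NM (ns_normal (repr (qpi y)) Nx) Ny.
by rewrite /conjg invgM !mulgA mulgK.
Qed.

Lemma qpiV x : quotientV (qpi x) = qpi x^-1.
Proof.
apply: qpi_eq; have := ns_normal x^-1 (NV (repr_qpi x)).
by rewrite /conjg !invgM !invgK !mulgA mulgV mul1g.
Qed.

Fact quotientA : associative quotientM.
Proof.
elim/quotient_ind=> x; elim/quotient_ind=> y; elim/quotient_ind=> z.
by rewrite !qpiM mulgA.
Qed.

Fact quotient1g : left_id quotient1 quotientM.
Proof. by elim/quotient_ind=> x; rewrite qpiM mul1g. Qed.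

Fact quotientg1 : right_id quotient1 quotientM.
Proof. by elim/quotient_ind=> x; rewrite qpiM mulg1. Qed.

Fact quotientVg : left_inverse quotient1 quotientV quotientM.
Proof. by elim/quotient_ind=> x; rewrite qpiV qpiM mulVg. Qed.

Fact quotientgV : right_inverse quotient1 quotientV quotientM.
Proof. by elim/quotient_ind=> x; rewrite qpiV qpiM mulgV. Qed.

HB.instance Definition _ := isGroup.Build quotient_group
  quotientA quotient1g quotientg1 quotientVg quotientgV.

End QuotientGroup.

Definition groups_isomorphic (G H : groupType) :=
  exists f : {multiplicative G -> H}, bijective f.

Section Inner.
Variable C : category.
Implicit Types F G : cat_aut C.

Definition inner F : Prop := nat_isomorphic (functor_id C) F.

Definition inner_pred : {pred cat_aut C} := fun F => `[< inner F >].

Fact innerV F : inner F -> inner (F^-1)%g.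
Proof.
move=> iF; rewrite /inner -[X in nat_isomorphic X _](aut_functorK F).
rewrite -[X in nat_isomorphic _ X]functor_compf1.
by apply: nat_isomorphic_comp; [exact: nat_isomorphic_refl |
  exact: nat_isomorphic_sym].
Qed.

Fact innerM F G : inner F -> inner G -> inner (F * G)%g.
Proof.
move=> iF iG; rewrite /inner -[X in nat_isomorphic X _]functor_compf1.
exact: nat_isomorphic_comp.
Qed.

Fact inner_group_closed : group_closed inner_pred.
Proof.
split; first by apply/asboolP; exact: nat_isomorphic_refl.
by move=> F G /asboolP iF /asboolP iG; apply/asboolP/innerM/innerV.
Qed.

Fact inner_normal (F G : cat_aut C) :
  G \in inner_pred -> (G ^ F)%g \in inner_pred.
Proof.
move=> /asboolP iG; apply/asboolP.
rewrite /inner -[X in nat_isomorphic X _](aut_functorK F).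
apply: nat_isomorphic_comp; first exact: nat_isomorphic_refl.
rewrite -[X in nat_isomorphic X _]functor_comp1f.
by apply: nat_isomorphic_comp => //; exact: nat_isomorphic_refl.
Qed.

Definition inner_auts : normal_subgroup (cat_aut C) :=
  NormalSubgroup inner_group_closed inner_normal.

End Inner.

Record field_aut (k : fieldType) := FieldAut {
  faut :> {rmorphism k -> k};
  fautV : {rmorphism k -> k};
  fautK : cancel faut fautV;
  fautVK : cancel fautV faut
}.

HB.instance Definition _ (k : fieldType) := gen_eqMixin (field_aut k).
HB.instance Definition _ (k : fieldType) := gen_choiceMixin (field_aut k).

Section FieldAutGroup.
Variable k : fieldType.
Implicit Types f g : field_aut k.

Lemma rmorphism_ext (f g : {rmorphism k -> k}) : f =1 g -> f = g.
Proof.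
case: f g => [f [[p1] [p2]]] [g [[q1] [q2]]] /= /funext fg; subst g.
by rewrite (Prop_irrelevance p1 q1) (Prop_irrelevance p2 q2).
Qed.

Lemma field_aut_ext f g : f =1 g -> f = g.
Proof.
case: f g => [f f' fK f'K] [g g' gK g'K] /= fg.
have {}fg := rmorphism_ext fg; subst g.
have f'g' : f' = g'.
  by apply: rmorphism_ext => x; rewrite -{1}[x]g'K fK.
subst g'.
by congr FieldAut; exact: Prop_irrelevance.
Qed.

Definition field_aut1 : field_aut k :=
  @FieldAut k idfun idfun (fun _ => erefl) (fun _ => erefl).

Definition field_autV f : field_aut k := FieldAut (fautVK f) (fautK f).

Definition field_autM f g : field_aut k :=
  @FieldAut k (f \o g) (fautV g \o fautV f)
    (can_comp (fautK f) (fautK g)) (can_comp (fautVK g) (fautVK f)).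

Fact field_autA : associative field_autM.
Proof. by move=> f g h; exact: field_aut_ext. Qed.

Fact field_aut1g : left_id field_aut1 field_autM.
Proof. by move=> f; exact: field_aut_ext. Qed.

Fact field_autg1 : right_id field_aut1 field_autM.
Proof. by move=> f; exact: field_aut_ext. Qed.

Fact field_autVg : left_inverse field_aut1 field_autV field_autM.
Proof. by move=> f; apply: field_aut_ext => x /=; exact: fautK. Qed.

Fact field_autgV : right_inverse field_aut1 field_autV field_autM.
Proof. by move=> f; apply: field_aut_ext => x /=; exact: fautVK. Qed.

HB.instance Definition _ := isGroup.Build (field_aut k)
  field_autA field_aut1g field_autg1 field_autVg field_autgV.

End FieldAutGroup.

(* The set X_0 of variables is nat; the object F(X) is represented by the
   finite set X, possibly empty. *)
Section Theta0.
Variable k : fieldType.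

Definition theta0_hom (X Y : {fset nat}) := alg_hom (freeAlg k X) (freeAlg k Y).

Definition theta0 : category.
Proof.
refine (@Category {fset nat} theta0_hom
  (fun X => alg_id (freeAlg k X)) (fun X Y Z g f => alg_comp g f) _ _ _).
all: by move=> *; exact: alg_hom_ext.
Defined.

End Theta0.

(* Main.v *)
Require Import Defs.
From HB Require Import structures.
From mathcomp Require Import all_boot all_algebra.
From mathcomp Require Import generic_quotient finmap boolp zify.

(* Let F(X) be the free commutative algebra on X.  An automorphism Y of the
   category sends F(x) to a free algebra on one generator, since these are the
   nonzero objects with no idempotent endomorphism besides 0 and 1.  As
   Hom(F(x), A) = A, it follows that Y is given by bijections s_A : A -> Y(A),
   Y(f) = s_B f s_A^-1.  Pulling the operations of Y(A) back along s_A yields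
   operations given by words w_c(x), w_+(x, y), w_*(x, y).  The w_c with c <> 0
   are invertible under substitution, hence w_c = phi(c) x by a degree argument.
   Since phi(2) is not a root of unity, commutation with the scalar phi(2)
   makes w_+ and w_* homogeneous of degrees 1 and 2, and inserting 0 for x or y
   leaves only w_+ = x + y and w_* = g xy with g in k^*.  Then phi is a field
   automorphism, depends only on Y, and after rescaling by g the s_A are algebra
   isomorphisms when phi = 1, so that Y is inner.  Conversely every field
   automorphism arises by acting on coefficients. *)

Set Implicit Arguments.
Unset Strict Implicit.
Unset Printing Implicit Defensive.

Import GRing.Theory.

Local Open Scope ring_scope.

(** * Homomorphisms and free algebras *)

Section AlgHomFacts.
Variables (k : fieldType) (A B : linAlgType k) (f : alg_hom A B).

Lemma alg_hom0 : f 0 = 0. Proof. exact: linear0. Qed.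

Lemma alg_homD a b : f (a + b) = f a + f b. Proof. exact: linearD. Qed.

Lemma alg_homZ c a : f (c *: a) = c *: f a. Proof. exact: linearZ. Qed.

End AlgHomFacts.

Lemma alg_compE (k : fieldType) (A B C : linAlgType k) (g : alg_hom B C)
  (f : alg_hom A B) a : alg_comp g f a = g (f a).
Proof. by []. Qed.

Section FreeAlgebraFacts.
Variables (k : fieldType) (X : Type).

Lemma free_ext (A : comLinAlgType k) (f g : alg_hom (freeAlg k X) A) :
  (forall x, f (gen k x) = g (gen k x)) -> f = g.
Proof.
move=> fg; have [h [_ hu]] := free_universal (fun x => f (gen k x)).
by rewrite -(hu f) // -(hu g).
Qed.

Lemma free_lift_gen (A : comLinAlgType k) (f : X -> A) x :
  free_lift f (gen k x) = f x.
Proof. exact: free_eval_pi. Qed.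

Lemma freeAlg_ind (P : freeAlg k X -> Prop) :
  (forall x, P (gen k x)) -> P 0 ->
  (forall a b, P a -> P b -> P (a + b)) ->
  (forall c a, P a -> P (c *: a)) ->
  (forall a b, P a -> P b -> P (amul a b)) ->
  forall a, P a.
Proof.
move=> Pg P0 PD PZ PM; elim/free_ind; elim=> [x||s IHs t IHt|s IHs t IHt|c s IHs].
- exact: Pg.
- exact: P0.
- by have := PD _ _ IHs IHt; rewrite [in X in X -> _]/+%R /= fpi_add.
- by have := PM _ _ IHs IHt; rewrite [in X in X -> _]/amul /= fpi_mul.
- by have := PZ c _ IHs; rewrite [in X in X -> _]/*:%R /= fpi_scale.
Qed.

End FreeAlgebraFacts.

Section AmulFacts.
Variables (k : fieldType) (A : linAlgType k).
Implicit Types x y : A.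

Lemma amul0l y : amul (0 : A) y = 0.
Proof. by rewrite -[X in amul X _](scale0r (0 : A)) amulZl scale0r. Qed.

Lemma amul0r x : amul x (0 : A) = 0.
Proof. by rewrite -[X in amul _ X](scale0r (0 : A)) amulZr scale0r. Qed.

Lemma amul_suml I r (P : pred I) (F : I -> A) y :
  amul (\sum_(i <- r | P i) F i) y = \sum_(i <- r | P i) amul (F i) y.
Proof.
exact: (big_morph (fun x => amul x y) (fun a b => amulDl a b y) (amul0l y)).
Qed.

Lemma amul_sumr I r (P : pred I) (F : I -> A) x :
  amul x (\sum_(i <- r | P i) F i) = \sum_(i <- r | P i) amul x (F i).
Proof.
exact: (big_morph (fun y => amul x y) (fun a b => amulDr x a b) (amul0r x)).
Qed.

End AmulFacts.

Lemma free_lift0 (k : fieldType) (X : Type) (A : comLinAlgType k) w :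
  free_lift (fun _ : X => 0 : A) w = 0.
Proof.
elim/freeAlg_ind: w => [x||a b IHa IHb|c a IHa|a b IHa IHb].
- exact: free_lift_gen.
- exact: linear0.
- by rewrite alg_homD IHa IHb addr0.
- by rewrite alg_homZ IHa scaler0.
- by rewrite alg_funM IHa amul0l.
Qed.

(** * Linear combinations with polynomials as coefficient families *)

Section LinearCombinations.
Variables (k : fieldType) (V : lmodType k) (e : nat -> V).
Implicit Types p q : {poly k}.

(** The polynomial serves only as a finitely supported family of coefficients, whose [size] marks
    the last index in use. *)
Definition lincomb p : V := \sum_(i < size p) p`_i *: e i.

Lemma lincombE n p : (size p <= n)%N -> lincomb p = \sum_(i < n) p`_i *: e i.
Proof.
move=> pn; rewrite /lincomb.
rewrite [RHS](bigID (fun i : 'I_n => (i < size p)%N)) /= [X in _ + X]big1 ?addr0.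
  by rewrite -(big_ord_widen n (fun i => p`_i *: e i) pn).
by move=> i; rewrite -leqNgt => /(nth_default 0) ->; rewrite scale0r.
Qed.

Fact lincomb_linear : linear lincomb.
Proof.
move=> c p q; pose n := maxn (size p) (size q).
have pn : (size p <= n)%N by exact: leq_maxl.
have qn : (size q <= n)%N by exact: leq_maxr.
have pqn : (size (c *: p + q)%R <= n)%N.
  rewrite (leq_trans (size_polyD _ _)) // geq_max qn andbT.
  exact: leq_trans (size_scale_leq _ _) pn.
rewrite (lincombE pn) (lincombE qn) (lincombE pqn) scaler_sumr -big_split /=.
by apply: eq_bigr => i _; rewrite coefD coefZ scalerA scalerDl.
Qed.
HB.instance Definition _ := GRing.isLinear.Build k _ _ *:%R lincomb lincomb_linear.

Lemma lincombXn n : lincomb 'X^n = e n.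
Proof.
rewrite /lincomb size_polyXn big_ord_recr /= coefXn eqxx scale1r big1 ?add0r //.
by move=> i _; rewrite coefXn ltn_eqF // scale0r.
Qed.

End LinearCombinations.

Lemma linear_lincomb (k : fieldType) (U V : lmodType k) (h : {linear U -> V})
  (e : nat -> U) (p : {poly k}) : h (lincomb e p) = lincomb (h \o e) p.
Proof. by rewrite linear_sum; apply: eq_bigr => i _; rewrite linearZ. Qed.

(** Since the degrees of the [e i] strictly increase and none of them is 0, the top term cannot be
    cancelled. *)
Lemma size_lincomb (k : fieldType) (e : nat -> {poly k}) (p : {poly k}) :
  e 0%N != 0 -> (forall m n, (m < n)%N -> (size (e m) < size (e n))%N) ->
  p != 0 -> size (lincomb e p) = size (e (size p).-1).
Proof.
move=> e0 lt_e p0; have [n sp] : exists n, size p = n.+1.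
  by exists (size p).-1; rewrite prednK // size_poly_gt0.
have pn0 : p`_n != 0 by move: p0; rewrite -lead_coef_eq0 lead_coefE sp.
have sn : size (p`_n *: e n) = size (e n) by rewrite size_scale.
have sn0 : (0 < size (e n))%N.
  case: (posnP n) => [->|n0]; first by rewrite size_poly_gt0.
  exact: leq_ltn_trans (lt_e _ _ n0).
rewrite /lincomb sp big_ord_recr /= addrC size_polyDl ?sn //.
apply: leq_ltn_trans (size_sum _ _ _) _; rewrite -(prednK sn0) ltnS.
apply/bigmax_leqP => i _; rewrite (leq_trans (size_scale_leq _ _)) //.
by rewrite -ltnS prednK // lt_e.
Qed.

(** * A commutative algebra that separates monomials by degree *)

Section PolyAlgebra.
Variable k : fieldType.

Definition spread : {poly k} -> {poly k} := lincomb (fun i => 'X^(2 ^ i)).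
HB.instance Definition _ := GRing.Linear.on spread.

Lemma size_spread p : p != 0 -> size (spread p) = (2 ^ (size p).-1).+1.
Proof.
move=> p0; rewrite size_lincomb ?size_polyXn ?polyXn_eq0 //.
  by rewrite -size_poly_gt0 size_polyXn.
by move=> m n mn; rewrite !size_polyXn ltnS ltn_exp2l.
Qed.

(* {poly k} with the multiplication (p, q) |-> spread p * spread q: it has no
   zero divisors, and the degree 2 ^ i + 2 ^ j of a product determines the set
   {i, j} of the degrees of its factors. *)
Definition polyAlg : Type := {poly k}.
HB.instance Definition _ := GRing.Lmodule.on polyAlg.

Definition polyAlg_mul (p q : polyAlg) : polyAlg := spread p * spread q.

Fact polyAlg_mulDl : left_distributive polyAlg_mul +%R.
Proof. by move=> p q r; rewrite /polyAlg_mul linearD mulrDl. Qed.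
Fact polyAlg_mulDr : right_distributive polyAlg_mul +%R.
Proof. by move=> p q r; rewrite /polyAlg_mul linearD mulrDr. Qed.
Fact polyAlg_mulZl (c : k) (p q : polyAlg) :
  polyAlg_mul (c *: p) q = c *: polyAlg_mul p q.
Proof. by rewrite /polyAlg_mul linearZ scalerAl. Qed.
Fact polyAlg_mulZr (c : k) (p q : polyAlg) :
  polyAlg_mul p (c *: q) = c *: polyAlg_mul p q.
Proof. by rewrite /polyAlg_mul linearZ scalerAr. Qed.
Fact polyAlg_mulC : commutative polyAlg_mul.
Proof. by move=> p q; rewrite /polyAlg_mul mulrC. Qed.

HB.instance Definition _ := Lmodule_isLinAlgebra.Build k polyAlg
  polyAlg_mulDl polyAlg_mulDr polyAlg_mulZl polyAlg_mulZr.
HB.instance Definition _ := LinAlgebra_isCommutative.Build k polyAlg polyAlg_mulC.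

Lemma size_polyAlg_mul (p q : polyAlg) : p != 0 -> q != 0 ->
  size (amul p q : {poly k}) =
  (2 ^ (size (p : {poly k})).-1 + 2 ^ (size (q : {poly k})).-1).+1.
Proof.
move=> p0 q0; rewrite {1}/amul /= /polyAlg_mul size_mul -?size_poly_eq0 ?size_spread //.
by rewrite addSn addnS.
Qed.

End PolyAlgebra.

(** * Nonassociative commutative monomials in one variable *)

Section Monomials.

Definition next_pair (u : nat * nat) : nat * nat :=
  if (u.2 < u.1)%N then (u.1, u.2.+1) else (u.1.+1, 0%N).

(* Lexicographic enumeration of the pairs (i, j) with j <= i. *)
Definition sorted_pair (n : nat) : nat * nat := iter n next_pair (0, 0)%N.

(** Both factors of the monomial of index [n.+1] have index at most [n]; hence the fuel in [mon]
    suffices and strong induction on the index works. *)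
Lemma sorted_pair_le n : ((sorted_pair n).2 <= (sorted_pair n).1 <= n)%N.
Proof.
elim: n => //= n; rewrite -/(sorted_pair n) /next_pair.
by case: (sorted_pair n) => i j /= /andP[ji i_n]; case: ltnP => /= h; lia.
Qed.

Lemma sorted_pair_surj i j : (j <= i)%N -> exists n, sorted_pair n = (i, j).
Proof.
elim: i j => [|i IHi]; first by case=> // _; exists 0%N.
elim=> [_|j IHj ji].
  have [n En] := IHi i (leqnn i); exists n.+1; rewrite /= -/(sorted_pair n) En.
  by rewrite /next_pair /= ltnn.
have [n En] := IHj (ltnW ji); exists n.+1; rewrite /= -/(sorted_pair n) En.
by rewrite /next_pair /= ji.
Qed.

Variables (k : fieldType) (A : linAlgType k).

(* Up to commutativity, mon a 0, mon a 1, ... are all nonassociative monomials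
   in a, each listed once. *)
Fixpoint mon_rec (fuel : nat) (a : A) (n : nat) : A :=
  if fuel is m.+1 then
    if n is n'.+1 then
      amul (mon_rec m a (sorted_pair n').1) (mon_rec m a (sorted_pair n').2)
    else a
  else 0.

Definition mon (a : A) (n : nat) : A := mon_rec n.+1 a n.

Lemma mon_rec_fuel m m' a n :
  (n < m)%N -> (n < m')%N -> mon_rec m a n = mon_rec m' a n.
Proof.
elim/ltn_ind: n m m' => n IHn [//|m] [//|m']; rewrite !ltnS => nm nm'.
case: n => [//|n] in IHn nm nm' *.
have /andP[ji i_n] := sorted_pair_le n; have j_n := leq_trans ji i_n.
by congr amul; apply: IHn; rewrite ?ltnS //;
  exact: leq_ltn_trans nm || exact: leq_ltn_trans nm'.
Qed.

Lemma mon0 a : mon a 0 = a. Proof. by []. Qed.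

Lemma monS a n : mon a n.+1 = amul (mon a (sorted_pair n).1) (mon a (sorted_pair n).2).
Proof.
have /andP[ji i_n] := sorted_pair_le n.
have j_n := leq_trans ji i_n.
change (amul (mon_rec n.+1 a (sorted_pair n).1) (mon_rec n.+1 a (sorted_pair n).2)
  = amul (mon a (sorted_pair n).1) (mon a (sorted_pair n).2)).
by congr amul; apply: mon_rec_fuel; rewrite ?ltnS.
Qed.

End Monomials.

Lemma alg_hom_mon (k : fieldType) (A B : linAlgType k) (h : alg_hom A B) a n :
  h (mon a n) = mon (h a) n.
Proof.
elim/ltn_ind: n => -[//|n] IHn; rewrite !monS alg_funM.
by have /andP[ji i_n] := sorted_pair_le n; rewrite !IHn ?ltnS //; exact: leq_trans i_n.
Qed.

Lemma sorted_pair_lt m n : (m < n)%N ->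
  ((sorted_pair m).1 < (sorted_pair n).1)%N \/
  (sorted_pair m).1 = (sorted_pair n).1 /\ ((sorted_pair m).2 < (sorted_pair n).2)%N.
Proof.
elim: n => // n IHn mn.
have : let u := sorted_pair n in let v := sorted_pair n.+1 in
  (u.1 < v.1)%N \/ u.1 = v.1 /\ (u.2 < v.2)%N.
  rewrite /= -/(sorted_pair n) /next_pair.
  by case: (sorted_pair n) => i j /=; case: (ltnP j i) => /= ?; lia.
case: (ltngtP m n) mn => [/IHn|//|-> //]; last by lia.
move: (sorted_pair m) (sorted_pair n) (sorted_pair n.+1).
by case=> [i j] [i' j'] [i'' j''] /=; lia.
Qed.

(** If [i < i'], then [2 ^ i + 2 ^ j <= 2 ^ i.+1 <= 2 ^ i'], so the lexicographic order of sorted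
    pairs becomes the order of degrees of products. *)
Lemma expn2_pair_lt (i j i' j' : nat) :
  (j <= i)%N -> (i < i')%N || (i == i') && (j < j')%N ->
  (2 ^ i + 2 ^ j < 2 ^ i' + 2 ^ j')%N.
Proof.
move=> ji /orP[ii'|/andP[/eqP <- jj']]; last by rewrite ltn_add2l ltn_exp2l.
have h1 : (2 ^ j <= 2 ^ i)%N by rewrite leq_exp2l.
have h2 : (2 ^ i.+1 <= 2 ^ i')%N by rewrite leq_exp2l.
have h3 : (0 < 2 ^ j')%N by rewrite expn_gt0.
by rewrite expnS in h2; lia.
Qed.

Section MonomialSize.
Variable k : fieldType.
Variable b : polyAlg k.
Hypothesis b0 : b != 0.

Lemma mon_neq0 n : mon b n != 0.
Proof.
elim/ltn_ind: n => -[//|n] IHn.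
have /andP[ji i_n] := sorted_pair_le n; have j_n := leq_trans ji i_n.
by rewrite monS -size_poly_gt0 size_polyAlg_mul ?IHn.
Qed.

(** By induction the degrees of the factors are ordered as their indices are, so the lexicographic
    order of the index pairs passes to the degrees of the products. *)
Lemma size_mon_lt m n : (m < n)%N ->
  (size (mon b m : {poly k}) < size (mon b n : {poly k}))%N.
Proof.
elim/ltn_ind: n m => -[//|n] IHn m mn.
have mon_ge l i : (l <= i)%N -> (i < n.+1)%N ->
    ((size (mon b l : {poly k})).-1 <= (size (mon b i : {poly k})).-1)%N.
  rewrite leq_eqVlt => /orP[/eqP -> //|li /IHn/(_ _ li) /ltnW h].
  by rewrite -!subn1 leq_sub2r.
have mon_gt l i : (l < i)%N -> (i < n.+1)%N ->
    ((size (mon b l : {poly k})).-1 < (size (mon b i : {poly k})).-1)%N.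
  move=> li /IHn/(_ _ li); have := mon_neq0 l; rewrite -size_poly_gt0.
  by case: (size _) => // r _; case: (size _).
have /andP[ji i_n] := sorted_pair_le n; have j_n := leq_trans ji i_n.
rewrite (monS b n) size_polyAlg_mul ?mon_neq0 //.
(* For [m = 0] the product has degree above [2 ^ d], where [d] is the degree of its first factor,
   and [2 ^ d] exceeds [d], which is at least the degree of [b]. *)
case: m mn => [_|m]; rewrite ?mon0.
  have := mon_ge 0%N (sorted_pair n).1 isT i_n; rewrite mon0.
  have := ltn_expl (size (mon b (sorted_pair n).1 : {poly k})).-1 (isT : 1 < 2)%N.
  by move: (2 ^ _)%N (2 ^ _)%N (size b) => u v w; lia.
rewrite ltnS => mn; have /andP[ji' i_m] := sorted_pair_le m.
rewrite monS size_polyAlg_mul ?mon_neq0 // ltnS expn2_pair_lt //.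
  by apply: mon_ge => //; rewrite ltnS (leq_trans i_m) // ltnW.
case: (sorted_pair_lt mn) => [lt1|[-> lt2]]; first by rewrite mon_gt.
by rewrite eqxx [X in _ || X]mon_gt ?orbT.
Qed.

End MonomialSize.

(** * The free algebra on one generator *)

Section OneGenerator.
Variables (k : fieldType) (X : Type) (x : X).
Hypothesis X1 : forall y, y = x.
Local Notation F := (freeAlg k X).

(** The span of the monomials is closed under products: by commutativity and [sorted_pair_surj], the
    product of two monomials is in the list again. *)
Lemma freeAlg_mon_span (w : F) : exists p, w = lincomb (mon (gen k x)) p.
Proof.
pose S (w : F) := exists p, w = lincomb (mon (gen k x)) p.
have S0 : S 0 by exists 0; rewrite linear0.
have SD a b : S a -> S b -> S (a + b).
  by move=> [p ->] [q ->]; exists (p + q); rewrite linearD.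
have SZ c a : S a -> S (c *: a).
  by move=> [p ->]; exists (c *: p); rewrite linearZ.
have SM i j : S (amul (mon (gen k x) i) (mon (gen k x) j)).
  wlog ji : i j / (j <= i)%N => [th|].
    by case: (leqP j i) => [/th //|/ltnW/th]; rewrite amulC.
  have [n En] := sorted_pair_surj ji.
  by exists 'X^(n.+1); rewrite lincombXn monS En.
move: w; apply: freeAlg_ind => //.
  by move=> y; exists 'X^0; rewrite lincombXn (X1 y).
move=> _ _ [p ->] [q ->]; rewrite amul_suml.
apply: (big_ind S) => // i _; rewrite amul_sumr.
apply: (big_ind S) => // j _; rewrite amulZl amulZr.
exact: (SZ _ _ (SZ _ _ (SM _ _))).
Qed.

(** By [size_lincomb] the value of [w] at [b] has the degree of its last monomial at [b], which
    exceeds that of [b] unless the monomial is the generator. *)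
Lemma eval_size_linear (b : polyAlg k) (w : F) : b != 0 ->
  (size (free_lift (fun=> b) w : {poly k}) <= size (b : {poly k}))%N ->
  exists c, w = c *: gen k x.
Proof.
move=> b0; have [p ->] := freeAlg_mon_span w.
rewrite linear_lincomb.
have -> : free_lift (fun=> b) \o mon (gen k x) = mon b.
  apply/funext => n; rewrite [LHS](alg_hom_mon (free_lift (fun=> b))).
  by rewrite free_lift_gen.
have [->|p0] := eqVneq p 0; first by exists 0; rewrite linear0 scale0r.
rewrite (size_lincomb _ _ p0); [|by []|exact: size_mon_lt].
case sp : (size p).-1 => [|n] => [_|]; last first.
  by have := size_mon_lt b0 (ltn0Sn n); rewrite mon0 ltnNge => /negP h /h.
exists p`_0; rewrite (@lincombE _ _ _ 1); last by move: sp; case: (size p) => // -[].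
by rewrite big_ord1.
Qed.

End OneGenerator.

Lemma gen_neq0 (k : fieldType) (X : Type) (x : X) : gen k x != 0.
Proof.
apply/eqP => /(congr1 (free_lift (fun _ : X => 1 : polyAlg k))).
by rewrite free_lift_gen alg_hom0; apply/eqP; exact: oner_neq0.
Qed.

Lemma amul_gen_neq0 (k : fieldType) (X : Type) (x y : X) :
  amul (gen k x) (gen k y) != 0.
Proof.
apply/eqP => /(congr1 (free_lift (fun _ : X => 1 : polyAlg k))).
rewrite alg_funM !free_lift_gen alg_hom0; apply/eqP.
by rewrite -size_poly_gt0 size_polyAlg_mul ?oner_neq0.
Qed.

Section OneGenerator.
Variables (k : fieldType) (X : Type) (x : X).
Hypothesis X1 : forall y, y = x.
Local Notation F := (freeAlg k X).
Local Notation ev1 := (free_lift (fun _ : X => 1 : polyAlg k)).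

Let ev1_subst (v w : F) :
  ev1 (free_lift (fun _ : X => v) w) = free_lift (fun _ : X => ev1 v) w.
Proof.
have -> // : free_lift (fun _ : X => ev1 v) = alg_comp ev1 (free_lift (fun _ : X => v)).
by apply: free_ext => y; rewrite alg_compE !free_lift_gen.
Qed.

(** Let [b] be the value of [v] at 1. Then [w] has the value 1 at [b], so [b] is nonzero and the
    value has degree at most that of [b]: [eval_size_linear] applies. *)
Lemma subst_right_inverse_linear (v w : F) :
  free_lift (fun _ : X => v) w = gen k x -> exists c, w = c *: gen k x.
Proof.
move=> /(congr1 ev1); rewrite ev1_subst free_lift_gen => e1.
have ev1_neq0 : ev1 v != 0.
  apply/eqP => v0; move: e1; rewrite v0.
  by rewrite free_lift0 => /esym/eqP; apply/negP; exact: oner_neq0.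
apply: (eval_size_linear X1 ev1_neq0); rewrite e1.
by rewrite size_poly1 size_poly_gt0.
Qed.

(** Let [b] be the value of [v] at 1. If [b] is nonzero, [v] fixes it; otherwise [v] maps 1 to 0.
    Neither raises the degree, so [v] is [c] times the generator, and idempotence forces [c] to be 0
    or 1. *)
Lemma subst_idempotent (v : F) :
  free_lift (fun _ : X => v) v = v -> v = 0 \/ v = gen k x.
Proof.
move=> vv; have [c vc] : exists c, v = c *: gen k x.
  have [v0|v0] := eqVneq (ev1 v) 0; last first.
    by apply: (eval_size_linear X1 v0); rewrite -ev1_subst vv.
  apply: (@eval_size_linear _ _ _ X1 1); first exact: oner_neq0.
  by rewrite v0 size_poly0.
have [c0|c0] := eqVneq c 0; first by left; rewrite vc c0 scale0r.
right; apply: (scalerI c0); rewrite -vc -[RHS]vv.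
by rewrite [X in _ = free_lift _ X]vc alg_homZ free_lift_gen.
Qed.

End OneGenerator.

(** * Homogeneous elements and eigenvectors of dilations *)

Section Homogeneous.
Variables (k : fieldType) (X : Type).
Local Notation F := (freeAlg k X).

Inductive homog : nat -> F -> Prop :=
| homog_gen x : homog 1 (gen k x)
| homog_zero d : homog d 0
| homogD d a b : homog d a -> homog d b -> homog d (a + b)
| homogZ d c a : homog d a -> homog d (c *: a)
| homogM d e a b : homog d a -> homog e b -> homog (d + e) (amul a b).

Lemma homog0 d a : homog d a -> d = 0%N -> a = 0.
Proof.
elim=> {d a} // [d a b _ IHa _ IHb d0|d c a _ IHa d0|d e a b _ IHa _ IHb de0].
- by rewrite IHa // IHb // addr0.
- by rewrite IHa // scaler0.
- by rewrite IHa ?amul0l //; lia.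
Qed.

(** A product of total degree 1 has a factor of degree 0, which vanishes by [homog0] because there
    is no unit. The degree stays a variable so that induction on the derivation applies. *)
Lemma homog1 (x y : X) d a : (forall z, z = x \/ z = y) -> homog d a -> d = 1%N ->
  exists c c', a = c *: gen k x + c' *: gen k y.
Proof.
move=> xy; elim=> {d a}
  [z _|d _|d a b _ IHa _ IHb d1|d c a _ IHa d1|d e a b Ha _ Hb _ de1].
- have [->|->] := xy z; first by exists 1, 0; rewrite scale1r scale0r addr0.
  by exists 0, 1; rewrite scale1r scale0r add0r.
- by exists 0, 0; rewrite !scale0r addr0.
- have [c [c' ->]] := IHa d1; have [e [e' ->]] := IHb d1.
  by exists (c + e), (c' + e'); rewrite !scalerDl addrACA.
- have [e [e' ->]] := IHa d1.
  by exists (c * e), (c * e'); rewrite scalerDr !scalerA.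
- exists 0, 0; rewrite !scale0r addr0.
  have [/(homog0 Ha) ->|/(homog0 Hb) ->] : d = 0%N \/ e = 0%N by lia.
    exact: amul0l.
  exact: amul0r.
Qed.

(** A product of total degree 2 either has a vanishing factor of degree 0 or multiplies two linear
    forms, whose mixed terms merge by commutativity. *)
Lemma homog2 (x y : X) d a : (forall z, z = x \/ z = y) -> homog d a -> d = 2 ->
  exists c c' c'', a = c *: amul (gen k x) (gen k x)
    + c' *: amul (gen k x) (gen k y) + c'' *: amul (gen k y) (gen k y).
Proof.
move=> xy; elim=> {d a}
  [//|d _|d a b _ IHa _ IHb d1|d c a _ IHa d1|d e a b Ha _ Hb _ de1].
- by exists 0, 0, 0; rewrite !scale0r !addr0.
- have [c [c' [c'' ->]]] := IHa d1; have [e [e' [e'' ->]]] := IHb d1.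
  exists (c + e), (c' + e'), (c'' + e''); rewrite !scalerDl addrACA.
  by congr (_ + _); exact: addrACA.
- have [e [e' [e'' ->]]] := IHa d1.
  by exists (c * e), (c * e'), (c * e''); rewrite !scalerDr !scalerA.
- case: (ltngtP d 1) => d1; last 1 first.
  + have e1 : e = 1%N by lia.
    have [c [c' ->]] := homog1 xy Ha d1; have [f [f' ->]] := homog1 xy Hb e1.
    exists (c * f), (c * f' + c' * f), (c' * f').
    rewrite amulDl !amulDr !amulZl !amulZr !scalerA scalerDl !addrA.
    by rewrite (amulC (gen k y) (gen k x)).
  + exists 0, 0, 0; rewrite !scale0r !addr0.
    by rewrite (homog0 Ha) ?amul0l //; lia.
  + exists 0, 0, 0; rewrite !scale0r !addr0.
    by rewrite (homog0 Hb) ?amul0r //; lia.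
Qed.

(* Sums of homogeneous elements of degrees less than n. *)
Fixpoint homog_sum (n : nat) (a : F) : Prop :=
  if n is m.+1 then exists b f, [/\ homog_sum m b, homog m f & a = b + f]
  else a = 0.

Lemma homog_sum0 n : homog_sum n 0.
Proof.
elim: n => //= n IHn; exists 0, 0; split=> //; first exact: homog_zero.
by rewrite addr0.
Qed.

Lemma homog_sumD n a b : homog_sum n a -> homog_sum n b -> homog_sum n (a + b).
Proof.
elim: n a b => [_ _ -> ->|n IHn _ _ /= [a [f [Sa Hf ->]]] [b [g [Sb Hg ->]]]].
  exact: addr0.
exists (a + b), (f + g); split; first exact: IHn; last by rewrite addrACA.
exact: homogD.
Qed.

Lemma homog_sumZ n c a : homog_sum n a -> homog_sum n (c *: a).
Proof.
elim: n a => [_ ->|n IHn _ /= [a [f [Sa Hf ->]]]]; first exact: scaler0.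
exists (c *: a), (c *: f); split; first exact: IHn; last by rewrite scalerDr.
exact: homogZ.
Qed.

Lemma homog_sumW m n a : (m <= n)%N -> homog_sum m a -> homog_sum n a.
Proof.
move=> /subnK <-; elim: (n - m)%N => // d IHd /IHd Sa; exists a, 0.
by split=> //; [exact: homog_zero | rewrite addr0].
Qed.

Lemma homog_homog_sum d a : homog d a -> homog_sum d.+1 a.
Proof.
by move=> Ha; exists 0, a; split=> //; [exact: homog_sum0 | rewrite add0r].
Qed.

Lemma homog_sumM m n a b :
  homog_sum m a -> homog_sum n b -> homog_sum (m + n) (amul a b).
Proof.
elim: m a => [_ -> _|m IHm _ [a [f [Sa Hf ->]]] Sb].
  by rewrite amul0l; exact: homog_sum0.
rewrite amulDl; apply: homog_sumD; first by exact: (homog_sumW _ (IHm _ Sa Sb)).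
elim: n b Sb {IHm} => [_ ->|n IHn _ [b [g [Sb Hg ->]]]].
  by rewrite amul0r; exact: homog_sum0.
rewrite amulDr; apply: homog_sumD; first by apply: (homog_sumW _ (IHn _ Sb)); lia.
by apply: (homog_sumW _ (homog_homog_sum (homogM Hf Hg))); lia.
Qed.

Lemma homog_sum_total a : exists n, homog_sum n a.
Proof.
elim/freeAlg_ind: a => [x||a b [m Sa] [n Sb]|c a [n Sa]|a b [m Sa] [n Sb]].
- by exists 2; apply: homog_homog_sum; exact: homog_gen.
- by exists 0%N.
- exists (maxn m n); apply: homog_sumD; first exact: homog_sumW (leq_maxl _ _) Sa.
  exact: homog_sumW (leq_maxr _ _) Sb.
- by exists n; exact: homog_sumZ.
- by exists (m + n)%N; exact: homog_sumM.
Qed.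

Variable c : k.
Hypothesis c_inj : injective (fun d => c ^+ d).
Let h : alg_hom F F := free_lift (fun x => c *: gen k x).

Lemma homog_dilation d a : homog d a -> h a = c ^+ d *: a.
Proof.
elim=> {d a} [x|d|d a b _ IHa _ IHb|d e a _ IHa|d e a b _ IHa _ IHb].
- exact: free_lift_gen.
- by rewrite alg_hom0 scaler0.
- by rewrite alg_homD scalerDr IHa IHb.
- by rewrite alg_homZ IHa !scalerA mulrC.
- by rewrite alg_funM IHa IHb amulZl amulZr scalerA exprD.
Qed.

Lemma homog_sum_dilation n a : homog_sum n a -> homog_sum n (h a).
Proof.
elim: n a => [_ ->|n IHn _ [a [f [Sa Hf ->]]]]; first exact: alg_hom0.
exists (h a), (h f); split; [exact: IHn| |exact: alg_homD].
by rewrite (homog_dilation Hf); exact: homogZ.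
Qed.

(** Applying [h] minus the scalar [c ^+ n] removes the top component [f]. For [d != n] this exhibits
    [a] itself as a sum of components of degree less than [n]; for [d = n] it shows that [b] is an
    eigenvector too. *)
Lemma dilation_eigen_homog d a : h a = c ^+ d *: a -> homog d a.
Proof.
have [n] := homog_sum_total a; elim: n d a => [|n IHn] d a.
  by move=> -> _; exact: homog_zero.
move=> [b [f [Sb Hf ab]]] ha.
have hb : h b - c ^+ n *: b = (c ^+ d - c ^+ n) *: a.
  rewrite scalerBl -ha ab alg_homD scalerDr (homog_dilation Hf).
  by rewrite opprD addrACA subrr addr0.
have [dn|dn] := eqVneq d n.
  rewrite dn ab in hb *; move: hb; rewrite subrr scale0r => /subr0_eq hb.
  by apply: homogD => //; exact: IHn.
apply: IHn ha; have cdn : c ^+ d - c ^+ n != 0.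
  by rewrite subr_eq0; apply: contra dn => /eqP/c_inj ->.
rewrite -[a]scale1r -(mulVf cdn) -scalerA -hb -scaleNr.
by apply: homog_sumZ; apply: homog_sumD; [exact: homog_sum_dilation | exact: homog_sumZ].
Qed.

End Homogeneous.

(** * Properties preserved by automorphisms of a category *)

Section Automorphisms.
Variable C : category.

(** The composite of an automorphism and its inverse equals the identity only propositionally; a
    variable [G] with an equation lets one rewrite transport all hom-sets. *)
Lemma functor_id_faithful (G : functor C C) : G = functor_id C ->
  forall (A B : C) (f g : Defs.hom A B), fmap G f = fmap G g -> f = g.
Proof. by move=> ->. Qed.

Lemma functor_id_full (G : functor C C) : G = functor_id C ->
  forall (A B : C) (h : Defs.hom (G A) (G B)),
  exists f : Defs.hom A B, fmap G f = h.
Proof. by move=> -> A B h; exists h. Qed.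

Lemma cat_aut_faithful (F : cat_aut C) (A B : C) (f g : Defs.hom A B) :
  fmap F f = fmap F g -> f = g.
Proof.
move=> fg; apply: (functor_id_faithful (aut_functorK F)).
exact: (congr1 (@fmap _ _ (aut_functorV F) (F A) (F B)) fg).
Qed.

Lemma cat_aut_full (F : cat_aut C) (A B : C) (h : Defs.hom (F A) (F B)) :
  exists f : Defs.hom A B, fmap F f = h.
Proof.
have [f fh] := functor_id_full (aut_functorK F) (fmap (aut_functorV F) h).
by exists f; exact: (@cat_aut_faithful (cat_autV F)).
Qed.

(** The zero endomorphism is described by composition alone, as fixed under left composition with
    everything; the first clause excludes the zero algebra. *)
Definition only_trivial_idempotents (A : C) :=
  (exists f : Defs.hom A A, f <> idm A) /\
  forall e : Defs.hom A A, compm e e = e ->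
    e = idm A \/ forall f : Defs.hom A A, compm f e = e.

Lemma only_trivial_idempotents_aut (F : cat_aut C) (A : C) :
  only_trivial_idempotents A -> only_trivial_idempotents (F A).
Proof.
move=> [[f f1] idA]; split.
  by exists (fmap F f); rewrite -fmap1 => /cat_aut_faithful.
move=> e'; have [e <-] := cat_aut_full e'; rewrite -fmapM => /cat_aut_faithful ee.
have [->|e0] := idA _ ee; [by left; rewrite fmap1 | right=> g'].
by have [g <-] := cat_aut_full g'; rewrite -fmapM e0.
Qed.

End Automorphisms.

(** * Categorical recognition of the free algebras on one generator *)

Section SingleGenerator.
Variable k : fieldType.
Local Notation Theta := (theta0 k).

Lemma single_only_trivial_idempotents (X : {fset nat}) (x : X) :
  (forall y, y = x) -> only_trivial_idempotents (X : Theta).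
Proof.
move=> X1; split.
  exists (free_lift (fun _ : X => 0 : freeAlg k X)).
  move=> /(congr1 (fun f : theta0_hom k X X => f (gen k x))).
  rewrite /= -[free_eval _ _]/(free_lift (fun _ : X => 0 : freeAlg k X) _).
  by rewrite free_lift0 => /esym/eqP; rewrite (negPf (gen_neq0 _ _)).
move=> e ee; pose v := (e : theta0_hom k X X) (gen k x).
have ev : e = free_lift (fun _ : X => v).
  by apply: free_ext => y; rewrite free_lift_gen (X1 y).
have vv : free_lift (fun _ : X => v) v = v.
  by rewrite -ev; exact: (congr1 (fun f : theta0_hom k X X => f (gen k x)) ee).
have [v0|v1] := subst_idempotent X1 vv.
  right=> f; apply: free_ext => y; rewrite (X1 y).
  rewrite -[LHS]/((f : theta0_hom k X X) v) -[RHS]/v v0; exact: alg_hom0.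
left; apply: free_ext => y; rewrite (X1 y); exact: v1.
Qed.

(* Otherwise killing one generator is a nontrivial idempotent. *)
Lemma only_trivial_idempotents_single (X : {fset nat}) :
  only_trivial_idempotents (X : Theta) -> exists x : X, forall y, y = x.
Proof.
move=> [[f f1] idX].
have [[x _]|X0] := pselect (exists x : X, True); last first.
  by case: f1; apply: free_ext => x; case: X0; exists x.
apply: contrapT => X1.
have [y yx] : exists y, y <> x.
  apply: contrapT => nx; case: X1; exists x => y.
  by apply: contrapT => yx; case: nx; exists y.
pose e : theta0_hom k X X :=
  free_lift (fun z => if z == y then 0 else gen k z).
have ex : e (gen k x) = gen k x.
  by rewrite free_lift_gen; case: eqP => // xy; case: yx.
have ey : e (gen k y) = 0 by rewrite free_lift_gen eqxx.
have ee : @compm Theta X X X e e = e.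
  apply: free_ext => z; rewrite -[LHS]/(e (e (gen k z))).
  have [->|zy] := eqVneq z y; first by rewrite ey alg_hom0.
  by rewrite [e (gen k z)]free_lift_gen (negPf zy) free_lift_gen (negPf zy).
have [e1|e0] := idX _ ee.
  move: (gen_neq0 k y); rewrite -ey e1 => /eqP; case.
  by move: ey; rewrite e1.
(* Composing with the zero endomorphism would make [e] zero, yet [e] fixes [x]. *)
move: (e0 (free_lift (fun _ : X => 0 : freeAlg k X))).
move=> /(congr1 (fun f : theta0_hom k X X => f (gen k x))).
rewrite ex -[LHS]/(free_lift _ (e _)) free_lift0 => /esym/eqP.
by rewrite (negPf (gen_neq0 _ _)).
Qed.

Lemma cat_aut_single (F : cat_aut Theta) (X : {fset nat}) (x : X) :
  (forall y, y = x) -> exists x' : (F X : {fset nat}), forall y, y = x'.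
Proof.
move=> X1; apply: only_trivial_idempotents_single.
by apply: only_trivial_idempotents_aut; exact: single_only_trivial_idempotents X1.
Qed.

End SingleGenerator.

Lemma exp2_inj_pchar0 (k : fieldType) : [pchar k] =i pred0 ->
  injective (fun d => 2%:R ^+ d : k).
Proof.
move=> /pcharf0P k0 d e; wlog de : d e / (d <= e)%N => [th|].
  by case: (leqP d e) => [/th //|/ltnW/th h /esym/h].
rewrite -!natrX => /esym/eqP; rewrite -subr_eq0 -natrB ?leq_exp2l //.
rewrite k0 subn_eq0 leq_exp2l // => ed; apply/eqP; rewrite eqn_leq de.
by rewrite ed.
Qed.

Lemma fset1_single (K : choiceType) (a : K) (x : [fset a]%fset) :
  x = [` fset11 a]%fset.
Proof. by apply: val_inj; case: x => x /=; rewrite inE => /eqP. Qed.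

(** * Natural bijections and the twist of scalars *)

Section NaturalBijections.
Variable k : fieldType.
Local Notation Theta := (theta0 k).
Local Notation free := (freeAlg k).

Definition tmap (F : functor Theta Theta) (A B : {fset nat})
  (f : theta0_hom k A B) : theta0_hom k (F A) (F B) := fmap F f.

Definition carrier_map (F : functor Theta Theta) :=
  forall A : {fset nat}, free A -> free (F A : {fset nat}).

Definition natural_bijection F (s : carrier_map F) :=
  (forall A, bijective (s A)) /\
  forall (A B : {fset nat}) (f : theta0_hom k A B) a,
    s B (f a) = tmap F f (s A a).

(** The scalar [c] of the target pulls back to the word [phi c *: x], so [phi] stands on the source
    side; this reverses the order in [twist_of_comp]. *)
Definition semilinear_wrt F (phi : k -> k) (s : carrier_map F) :=
  forall A c a, s A (phi c *: a) = c *: s A a.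

Let O : {fset nat} := [fset 0%N]%fset.
Let o : O := [` fset11 0%N]%fset.
Let O1 (x : O) : x = o. Proof. exact: fset1_single. Qed.
Let g0 : free O := gen k o.

Let nu (A : {fset nat}) (a : free A) : theta0_hom k O A :=
  free_lift (fun _ : O => a).

Let nu_g0 (A : {fset nat}) (a : free A) : nu a g0 = a.
Proof. exact: free_lift_gen. Qed.

Let nu_id (a : free O) : nu g0 a = a.
Proof.
have -> // : nu g0 = alg_id (free O).
by apply: free_ext => x; rewrite (O1 x) nu_g0.
Qed.

(** The map [s A] is the composite of A = Hom(O, A), the action of [F] onto Hom(F O, F A), and
    evaluation at the single generator [y] of F O. *)
Lemma natural_bijection_exists (F : cat_aut Theta) :
  exists s : carrier_map F, natural_bijection s.
Proof.
have [y F1] := cat_aut_single F O1.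
pose s : carrier_map F := fun A a => tmap F (nu a) (gen k y).
have s_nat (A B : {fset nat}) (f : theta0_hom k A B) a :
    s B (f a) = tmap F f (s A a).
  rewrite /s; have -> : nu (f a) = alg_comp f (nu a).
    by apply: free_ext => z; rewrite alg_compE /nu !free_lift_gen.
  exact: (congr1 (fun h : theta0_hom k _ _ => h (gen k y)) (fmapM F f (nu a))).
exists s; split=> // A.
have s_inj : injective (s A).
  move=> a b ab; have : nu a = nu b.
    apply: (@cat_aut_faithful _ F O A); apply: free_ext => z.
    by rewrite (F1 z).
  by move/(congr1 (fun f : theta0_hom k O A => f g0)); rewrite !nu_g0.
have s_surj b : exists a, s A a = b.
  pose h : theta0_hom k (F O) (F A) := free_lift (fun=> b).
  have [f fh] := @cat_aut_full _ F O A h.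
  exists ((f : theta0_hom k O A) g0); rewrite /s.
  have -> : nu ((f : theta0_hom k O A) g0) = f.
    by apply: free_ext => z; rewrite (O1 z) nu_g0.
  by rewrite /tmap fh free_lift_gen.
pose t b := projT1 (cid (s_surj b)).
have tK : cancel t (s A) by move=> b; rewrite /t; case: (cid _).
by exists t => // a; apply: s_inj; rewrite tK.
Qed.

Section OneBijection.
Variables (F : functor Theta Theta) (s : carrier_map F).
Hypothesis s_nat_bij : natural_bijection s.

Let s_inj (A : {fset nat}) : injective (@s A).
Proof. by case: s_nat_bij => /(_ A)/bij_inj. Qed.
Let s_surj A (b : free (F A : {fset nat})) : exists a, s a = b.
Proof. by case: s_nat_bij => /(_ A)[t _ tK] _; exists (t b). Qed.
Let s_nat := proj2 s_nat_bij.

(** Apply naturality along the zero endomorphism to the preimage of 0. *)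
Lemma natural_bijection0 (A : {fset nat}) : s (0 : free A) = 0.
Proof.
have [z z0] := s_surj (0 : free (F A : {fset nat})).
have := s_nat (free_lift (fun _ : A => 0 : free A)) z.
by rewrite free_lift0 z0 alg_hom0.
Qed.

Lemma semilinear_exists : exists phi, semilinear_wrt phi s.
Proof.
(* The word is the preimage of [c *: s g0]; naturality along [nu a] carries the equation from the
   generator to [a]. *)
have wordP c : exists w : free O,
    forall (A : {fset nat}) (a : free A), s (nu a w) = c *: s a.
  have [w sw] := s_surj (c *: s g0); exists w => A a.
  by rewrite s_nat sw alg_homZ -s_nat nu_g0.
have word_linear c : exists d,
    forall (A : {fset nat}) (a : free A), s (d *: a) = c *: s a.
  have [c0|c0] := eqVneq c 0.
    by exists 0 => A a; rewrite c0 !scale0r natural_bijection0.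
  (* The words for [c] and its inverse are mutually inverse under substitution, so [w] is linear. *)
  have [w wP] := wordP c; have [v vP] := wordP c^-1.
  have [d wd] : exists d, w = d *: g0.
    apply: (subst_right_inverse_linear O1 (v := v)).
    by apply: s_inj; rewrite -/(nu v) wP -[v]nu_id vP scalerA divff // scale1r.
  by exists d => A a; rewrite -wP wd alg_homZ nu_g0.
by exists (fun c => projT1 (cid (word_linear c))) => A c a; case: (cid _).
Qed.

Let s_gen_neq0 : s g0 != 0.
Proof.
apply/eqP; rewrite -(natural_bijection0 O) => /s_inj/eqP.
by rewrite (negPf (gen_neq0 _ _)).
Qed.

Variable phi : k -> k.
Hypothesis s_phi : semilinear_wrt phi s.

Let scale_g0_inj (c d : k) : c *: g0 = d *: g0 -> c = d.
Proof.
move/eqP; rewrite -subr_eq0 -scalerBl scaler_eq0 (negPf (gen_neq0 _ _)) orbF.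
by rewrite subr_eq0 => /eqP.
Qed.

Lemma semilinear1 : phi 1 = 1.
Proof. by apply: scale_g0_inj; apply: s_inj; rewrite s_phi !scale1r. Qed.

Lemma semilinearM : {morph phi : c d / c * d}.
Proof.
move=> c d; apply: scale_g0_inj; apply: s_inj.
by rewrite -scalerA !s_phi scalerA.
Qed.

(** Through [s] the powers of [phi 2] act as the powers of 2, which are distinct in characteristic
    0. *)
Let exp_inj : [pchar k] =i pred0 -> injective (fun d => phi 2%:R ^+ d).
Proof.
move=> k0 d e /= de; apply: (exp2_inj_pchar0 k0).
have sX n : s (phi 2%:R ^+ n *: g0) = 2%:R ^+ n *: s g0.
  elim: n => [|n IHn]; first by rewrite !expr0 !scale1r.
  by rewrite !exprS -!scalerA s_phi IHn.
have := sX d; rewrite de sX => /eqP.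
rewrite -subr_eq0 -scalerBl scaler_eq0 (negPf s_gen_neq0) orbF subr_eq0.
by move=> /eqP.
Qed.

Let P : {fset nat} := [fset 0%N; 1%N]%fset.
Let x : P := [` fset21 0%N 1%N]%fset.
Let y : P := [` fset22 0%N 1%N]%fset.
Let P2 (z : P) : z = x \/ z = y.
Proof.
case: z => z zP; have := zP; rewrite !inE => /orP[]/eqP z01; [left|right];
exact: val_inj.
Qed.
Let mu (A : {fset nat}) (a b : free A) : theta0_hom k P A :=
  free_lift (fun z : P => if z == x then a else b).
Let mu_x (A : {fset nat}) (a b : free A) : mu a b (gen k x) = a.
Proof. by rewrite /mu free_lift_gen eqxx. Qed.
Let mu_y (A : {fset nat}) (a b : free A) : mu a b (gen k y) = b.
Proof. by rewrite /mu free_lift_gen. Qed.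

Let dilation : theta0_hom k P P := free_lift (fun z => phi 2%:R *: gen k z).

Lemma natural_bijectionD : [pchar k] =i pred0 ->
  forall (A : {fset nat}) (a b : free A), s (a + b) = s a + s b.
Proof.
move=> k0; have [w sw] := s_surj (s (gen k x) + s (gen k y)).
have wP (A : {fset nat}) (a b : free A) : s (mu a b w) = s a + s b.
  by rewrite s_nat sw alg_homD -!s_nat mu_x mu_y.
(* Under [s], the dilation by [phi 2] doubles both summands and hence the sum, so [w] is an
   eigenvector for [phi 2]. *)
have Hw : homog 1 w.
  apply: (dilation_eigen_homog (exp_inj k0)); rewrite expr1; apply: s_inj.
  rewrite -/dilation s_nat sw alg_homD -!s_nat /dilation !free_lift_gen !s_phi.
  by rewrite -scalerDr sw.
have [c [d wE]] := homog1 P2 Hw erefl.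
have muE (A : {fset nat}) (a b : free A) : mu a b w = c *: a + d *: b.
  by rewrite wE alg_homD !alg_homZ mu_x mu_y.
(* Inserting 0 for one variable isolates the coefficient of the other. *)
have cE (A : {fset nat}) (a : free A) : c *: a = a.
  apply: s_inj; rewrite -[c *: a]addr0 -(scaler0 _ d) -muE wP.
  by rewrite natural_bijection0 addr0.
have dE (A : {fset nat}) (a : free A) : d *: a = a.
  apply: s_inj; rewrite -[d *: a]add0r -(scaler0 _ c) -muE wP.
  by rewrite natural_bijection0 add0r.
by move=> A a b; rewrite -wP muE cE dE.
Qed.

Lemma natural_bijectionM : [pchar k] =i pred0 ->
  exists c, forall (A : {fset nat}) (a b : free A),
    s (c *: amul a b) = amul (s a) (s b).
Proof.
move=> k0; have [w sw] := s_surj (amul (s (gen k x)) (s (gen k y))).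
have wP (A : {fset nat}) (a b : free A) : s (mu a b w) = amul (s a) (s b).
  by rewrite s_nat sw alg_funM -!s_nat mu_x mu_y.
(* Both factors are doubled, so the eigenvalue is the square of [phi 2]. *)
have Hw : homog 2 w.
  apply: (dilation_eigen_homog (exp_inj k0)); rewrite expr2; apply: s_inj.
  rewrite -/dilation s_nat sw alg_funM -!s_nat /dilation !free_lift_gen !s_phi.
  by rewrite amulZl amulZr -scalerA !s_phi sw.
have [d [c [e wE]]] := homog2 P2 Hw erefl.
have muE (A : {fset nat}) (a b : free A) :
    mu a b w = d *: amul a a + c *: amul a b + e *: amul b b.
  by rewrite wE !alg_homD !alg_homZ !alg_funM mu_x mu_y.
(* With 0 as second argument only the square of [a] survives in the word, while the product it
   represents is 0. *)
have dE (A : {fset nat}) (a : free A) : d *: amul a a = 0.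
  apply: s_inj; rewrite natural_bijection0 -(amul0r (s a)) -(natural_bijection0 A).
  by rewrite -wP muE !amul0r !scaler0 !addr0.
have eE (A : {fset nat}) (a : free A) : e *: amul a a = 0.
  apply: s_inj; rewrite natural_bijection0 -(amul0l (s a)) -(natural_bijection0 A).
  by rewrite -wP muE !amul0l !scaler0 !add0r.
by exists c => A a b; rewrite -wP muE dE eE add0r addr0.
Qed.

Lemma semilinearD : [pchar k] =i pred0 -> {morph phi : c d / c + d}.
Proof.
move=> k0 c d; apply: scale_g0_inj; apply: s_inj.
by rewrite scalerDl natural_bijectionD // !s_phi scalerDl.
Qed.

End OneBijection.

(* If F acts on coefficients by f, then phi is the inverse of f. *)
Definition twist_of (F : functor Theta Theta) (phi : k -> k) :=
  exists s : carrier_map F, natural_bijection s /\ semilinear_wrt phi s.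

Lemma twist_of_id : twist_of (functor_id Theta) id.
Proof.
by exists (fun A a => a); split; [split; [move=> A; exists id|]|].
Qed.

Lemma twist_of_comp F G phi psi :
  twist_of F phi -> twist_of G psi -> twist_of (functor_comp F G) (psi \o phi).
Proof.
move=> [s [[s_bij s_nat] s_phi]] [t [[t_bij t_nat] t_psi]].
exists (fun A a => s (G A) (t A a)); split; last by move=> A c a; rewrite t_psi s_phi.
split=> [A|A B f a]; first exact: (bij_comp (s_bij (G A)) (t_bij A)).
by rewrite t_nat s_nat.
Qed.

(** Two natural bijections for [F] differ by a word invertible under substitution, hence by a
    nonzero scalar [d], which commutes with the action of scalars. *)
Lemma twist_of_unique F phi psi : twist_of F phi -> twist_of F psi -> phi =1 psi.
Proof.
move=> [s [s_nat_bij s_phi]] [t [t_nat_bij t_psi]] c.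
have [[s_bij s_nat] [t_bij t_nat]] := (s_nat_bij, t_nat_bij).
have [s' _ s'K] := s_bij O; have [t' _ t'K] := t_bij O.
have t_inj : injective (t O) := bij_inj (t_bij O).
pose v := t' (s O g0); pose w := s' (t O g0).
have vP (a : free O) : t O (nu a v) = s O a.
  by rewrite t_nat t'K -s_nat nu_g0.
have [d vE] : exists d, v = d *: g0.
  apply: (subst_right_inverse_linear O1 (v := w)).
  by apply: t_inj; rewrite -/(nu w) vP s'K.
have dP (a : free O) : t O (d *: a) = s O a by rewrite -vP vE alg_homZ nu_g0.
have d0 : d != 0.
  apply/eqP => d0; have : g0 = 0.
    apply: (bij_inj (s_bij O)); rewrite -!dP d0 !scale0r //.
  by apply/eqP; exact: gen_neq0.
have : d *: (phi c *: g0) = d *: (psi c *: g0).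
  apply: t_inj; rewrite dP s_phi -dP -t_psi scalerA mulrC -scalerA.
  by rewrite scalerA mulrC -scalerA.
move/(scalerI d0)/eqP; rewrite -subr_eq0 -scalerBl scaler_eq0.
by rewrite (negPf (gen_neq0 _ _)) orbF subr_eq0 => /eqP.
Qed.

End NaturalBijections.

(** * The action of field automorphisms on coefficients *)

Section CoefficientMap.
Variables (k : fieldType) (X : Type).

Fixpoint term_map (f : k -> k) (t : term k X) : term k X :=
  match t with
  | TVar x => TVar x
  | TZero => TZero
  | TAdd s t => TAdd (term_map f s) (term_map f t)
  | TMul s t => TMul (term_map f s) (term_map f t)
  | TScale c s => TScale (f c) (term_map f s)
  end.

Lemma term_map_equiv (f : {rmorphism k -> k}) s t :
  com_equiv s t -> com_equiv (term_map f s) (term_map f t).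
Proof.
elim=> {s t}; rewrite /= ?rmorphN ?rmorph1;
  try by move=> *; rewrite /= ?rmorphM ?rmorphD ?rmorphN ?rmorph1; constructor.
by move=> s t u _ st _; exact: ce_trans.
Qed.

Lemma term_map_can (f g : k -> k) : cancel f g -> cancel (term_map f) (term_map g).
Proof. by move=> fK; elim=> //= [s -> t ->|s -> t ->|c s ->] //; rewrite fK. Qed.

(** This map is only semilinear, so it is induced from terms and not obtained from [free_lift]. *)
Definition coef_map (f : k -> k) (a : freeAlg k X) : freeAlg k X :=
  fpi (term_map f (repr a)).

Section Rmorphism.
Variable f : {rmorphism k -> k}.

Lemma coef_map_pi t : coef_map f (fpi t) = fpi (term_map f t).
Proof. by apply: fpi_eq; apply: term_map_equiv; exact: com_equiv_repr. Qed.

Lemma coef_mapD : {morph coef_map f : a b / a + b}.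
Proof.
elim/free_ind=> s; elim/free_ind=> t.
by rewrite /+%R /= fpi_add !coef_map_pi fpi_add.
Qed.

Lemma coef_mapM : {morph coef_map f : a b / amul a b}.
Proof.
elim/free_ind=> s; elim/free_ind=> t.
by rewrite /amul /= fpi_mul !coef_map_pi fpi_mul.
Qed.

Lemma coef_mapZ c a : coef_map f (c *: a) = f c *: coef_map f a.
Proof.
elim/free_ind: a => s.
by rewrite /*:%R /= fpi_scale !coef_map_pi fpi_scale.
Qed.

End Rmorphism.

Lemma coef_map_can (f g : {rmorphism k -> k}) :
  cancel f g -> cancel (coef_map f) (coef_map g).
Proof.
by move=> fK; elim/free_ind=> t; rewrite !coef_map_pi term_map_can.
Qed.

End CoefficientMap.

Lemma functor_ext (C D : category) (o : C -> D)
    (m m' : forall A B : C, Defs.hom A B -> Defs.hom (o A) (o B)) p1 pM q1 qM :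
  (forall A B f, m A B f = m' A B f) ->
  @Functor C D o m p1 pM = @Functor C D o m' q1 qM.
Proof.
move=> mm'; have E : m = m'.
  apply: functional_extensionality_dep => A.
  by apply: functional_extensionality_dep => B; apply/funext.
by move: q1 qM; rewrite -E => q1 qM; exact: functor_eq.
Qed.

Section CoefficientAutomorphism.
Variable k : fieldType.
Local Notation Theta := (theta0 k).

Section Conjugate.
Variables (f : field_aut k) (A B : {fset nat}) (h : theta0_hom k A B).

Let conj_fun a := coef_map f (h (coef_map (fautV f) a)).

Fact coef_conj_linear : linear conj_fun.
Proof.
move=> c a b; rewrite /conj_fun coef_mapD coef_mapZ alg_homD alg_homZ.
by rewrite coef_mapD coef_mapZ fautVK.
Qed.

Fact coef_conjM : {morph conj_fun : a b / amul a b}.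
Proof. by move=> a b; rewrite /conj_fun coef_mapM alg_funM coef_mapM. Qed.

Definition coef_conj : theta0_hom k A B := AlgHom coef_conj_linear coef_conjM.

Lemma coef_conjE a : coef_conj a = coef_map f (h (coef_map (fautV f) a)).
Proof. by []. Qed.

End Conjugate.

Section Functor.
Variable f : field_aut k.

Fact coef_functor1 (A : Theta) : coef_conj f (idm A) = idm A.
Proof.
by apply: alg_hom_ext => a; rewrite coef_conjE; exact: (coef_map_can (fautVK f)).
Qed.

Fact coef_functorM (A B E : Theta) (g : Defs.hom B E) (h : Defs.hom A B) :
  coef_conj f (compm g h) = @compm Theta A B E (coef_conj f g) (coef_conj f h).
Proof.
apply: alg_hom_ext => a; rewrite [RHS]alg_compE !coef_conjE.
by rewrite (coef_map_can (fautK f)).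
Qed.

Definition coef_functor : functor Theta Theta :=
  @Functor Theta Theta id (@coef_conj f) coef_functor1 coef_functorM.

End Functor.

Lemma coef_functorK (f : field_aut k) :
  functor_comp (coef_functor (field_autV f)) (coef_functor f) = functor_id Theta.
Proof.
apply: (@functor_ext Theta Theta id) => A B h; apply: alg_hom_ext => a.
rewrite -[LHS]/(coef_conj (field_autV f) (coef_conj f h) a) !coef_conjE /=.
by rewrite !(coef_map_can (fautK f)).
Qed.

Lemma field_autVK (f : field_aut k) : field_autV (field_autV f) = f.
Proof. exact: field_aut_ext. Qed.

Definition coef_aut (f : field_aut k) : cat_aut Theta.
Proof.
apply: (@CatAut _ (coef_functor f) (coef_functor (field_autV f))).
  exact: coef_functorK.
by rewrite -{1}[f]field_autVK; exact: coef_functorK.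
Defined.

Lemma twist_of_coef_aut f : twist_of (coef_aut f) (fautV f).
Proof.
exists (fun A => coef_map f); split; last by move=> A c a; rewrite coef_mapZ fautVK.
split=> [A|A B h a].
  by exists (coef_map (fautV f)); apply: coef_map_can; [exact: fautK|exact: fautVK].
by rewrite [RHS]coef_conjE (coef_map_can (fautK f)).
Qed.

End CoefficientAutomorphism.

(** * The kernel and the final isomorphism *)

Section Kernel.
Variables (k : fieldType) (F : cat_aut (theta0 k)).

Lemma inner_twist_of : inner F -> twist_of F id.
Proof.
move=> [s [s_iso s_nat]].
exists (fun A : {fset nat} => alg_fun (s A : theta0_hom k A (F A))).
split; last by move=> A c a; exact: alg_homZ.
split=> [A|A B f a].
  have [t [ts st]] := s_iso A; exists (alg_fun (t : theta0_hom k (F A) A)) => a.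
    exact: (congr1 (fun h : theta0_hom k A A => h a) ts).
  exact: (congr1 (fun h : theta0_hom k (F A) (F A) => h a) st).
exact: (congr1 (fun h : theta0_hom k A (F B) => h a) (esym (s_nat A B f))).
Qed.

Lemma twist_of_inner : [pchar k] =i pred0 -> twist_of F id -> inner F.
Proof.
move=> k0 [s [s_nb s_id]]; have [s_bij s_nat] := s_nb.
have sD := natural_bijectionD s_nb s_id k0.
have [c sM] := natural_bijectionM s_nb s_id k0.
(* Otherwise all products in the image would vanish, but the square of a generator does not. *)
have c0 : c != 0.
  have [y _] := cat_aut_single F (@fset1_single _ 0%N).
  have [t _ tK] := s_bij [fset 0%N]%fset; apply/eqP => c0.
  have /eqP := sM _ (t (gen k y)) (t (gen k y)).
  rewrite !tK c0 scale0r (natural_bijection0 s_nb) eq_sym.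
  by rewrite (negPf (amul_gen_neq0 _ _ _)).
(* The product of [r a] and [r b] is [s] of [c * c^-1 * c^-1] times the product of [a] and [b], so
   this rescaling is multiplicative. *)
pose r (A : {fset nat}) (a : freeAlg k A) := s A (c^-1 *: a).
have r_inj A : injective (r A).
  move=> a b /(bij_inj (s_bij A)) /(scalerI (invr_neq0 c0)) //.
have r_surj A b : exists a, r A a = b.
  have [t _ tK] := s_bij A; exists (c *: t b).
  by rewrite /r scalerA mulVf // scale1r tK.
have r_lin A : linear (r A).
  by move=> d a b; rewrite /r scalerDr sD scalerA mulrC -scalerA s_id.
have rM A : {morph (r A) : a b / amul a b}.
  move=> a b; rewrite /r -sM amulZl amulZr !scalerA.
  by rewrite mulrA divff // mul1r.
pose rh A : theta0_hom k A (F A) := AlgHom (r_lin A) (rM A).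
pose t A b := projT1 (cid (r_surj A b)).
have tK A : cancel (t A) (r A) by move=> b; rewrite /t; case: (cid _).
have rK A : cancel (r A) (t A) by move=> a; apply: r_inj; rewrite tK.
have t_lin A : linear (t A).
  by move=> d a b; apply: r_inj; rewrite r_lin !tK.
have tM A : {morph (t A) : a b / amul a b}.
  by move=> a b; apply: r_inj; rewrite rM !tK.
pose th A : theta0_hom k (F A) A := AlgHom (t_lin A) (tM A).
exists rh; split=> [A|A B f].
  by exists (th A); split; apply: alg_hom_ext => a; [exact: rK | exact: tK].
apply: alg_hom_ext => a.
rewrite -[LHS]/(tmap F f (r A a)) -[RHS]/(r B ((f : theta0_hom k A B) a)).
by rewrite /r -alg_homZ s_nat.
Qed.

End Kernel.

(** Bijectivity of the twist comes from the inverse functor: both composites are the identity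
    functor, whose twist is [id] by uniqueness. *)
Lemma twist_exists (k : fieldType) (F : cat_aut (theta0 k)) :
  [pchar k] =i pred0 -> exists f : field_aut k, twist_of F (fautV f).
Proof.
move=> k0.
have rmorph_twist (G : cat_aut (theta0 k)) :
    exists phi : {rmorphism k -> k}, twist_of G phi.
  have [s s_nb] := natural_bijection_exists G.
  have [phi s_phi] := semilinear_exists s_nb.
  have phiD := semilinearD s_nb s_phi k0.
  have phi1 := semilinear1 s_nb s_phi; have phiM := semilinearM s_nb s_phi.
  have phi0 : phi 0 = 0 by apply: (addIr (phi 0)); rewrite -phiD !add0r.
  pose aD := GRing.isNmodMorphism.Build k k phi (conj phi0 phiD).
  pose aM := GRing.isMonoidMorphism.Build k k phi (conj phi1 phiM).
  pose phiR : {rmorphism k -> k} := HB.pack phi aD aM.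
  by exists phiR, s.
have [phi F_phi] := rmorph_twist F; have [psi V_psi] := rmorph_twist (cat_autV F).
have FV := twist_of_comp V_psi F_phi; rewrite aut_functorK in FV.
have VF := twist_of_comp F_phi V_psi; rewrite aut_functorVK in VF.
have psiK : cancel psi phi by exact: (twist_of_unique FV (twist_of_id k)).
have phiK : cancel phi psi by exact: (twist_of_unique VF (twist_of_id k)).
by exists (FieldAut psiK phiK).
Qed.

Theorem theorem4p3 (k : fieldType) (char0 : [pchar k] =i pred0) :
  groups_isomorphic (quotient_group (inner_auts (theta0 k))) (field_aut k).
Proof.
pose tw (F : cat_aut (theta0 k)) := projT1 (cid (twist_exists F char0)).
have twP (F : cat_aut (theta0 k)) : twist_of F (fautV (tw F))
  by rewrite /tw; case: (cid _).
have tw_eq (F : cat_aut (theta0 k)) (f : field_aut k) :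
    twist_of F (fautV f) -> tw F = f.
  move=> Ff; have E := twist_of_unique (twP F) Ff.
  by apply: field_aut_ext => c; rewrite -[LHS](fautVK f) -E fautK.
(* Twists compose in reverse order, and so do the inverses [fautV]; the order of the product is thus
   kept. *)
have twM : {morph tw : F G / (F * G)%g}.
  by move=> F G; apply: tw_eq; exact: (twist_of_comp (twP F) (twP G)).
have twV F : tw (F^-1)%g = ((tw F)^-1)%g.
  apply: (@mulgI _ (tw F)); rewrite -twM !mulgV; apply: tw_eq; exact: twist_of_id.
have tw_inner F : F \in inner_pred (C := theta0 k) <-> tw F = 1%g.
  split=> [/asboolP iF|F1]; first by apply: tw_eq; exact: inner_twist_of.
  by apply/asboolP/twist_of_inner => //; have := twP F; rewrite F1.
pose q := fun a : quotient_group (inner_auts (theta0 k)) => tw (repr a).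
(* The representative differs from [F] by an inner automorphism, which [tw] kills. *)
have q_pi F : q (qpi _ F) = tw F.
  have /tw_inner := repr_qpi (inner_auts (theta0 k)) F.
  rewrite twM twV => /(congr1 (fun f => q (qpi _ F) * f)%g).
  by rewrite mulgA mulgV mul1g mulg1.
have qM : {morph q : a b / (a * b)%g}.
  by elim/quotient_ind=> F; elim/quotient_ind=> G; rewrite [(_ * _)%g]qpiM !q_pi twM.
pose qMix := isMultiplicative.Build _ _ q qM.
pose qH : {multiplicative _ -> _} := HB.pack q qMix.
(* [F] and [coef_aut (tw F)] have the same image under [tw], so they lie in one coset of the
   kernel. *)
exists qH; exists (fun f => qpi _ (coef_aut f)).
  elim/quotient_ind=> F; apply: qpi_eq; apply/tw_inner.
  rewrite [qH _]q_pi twM twV (tw_eq _ _ (twist_of_coef_aut (tw F))).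
  exact: mulVg.
by move=> f; rewrite [LHS]q_pi; apply: tw_eq; exact: twist_of_coef_aut.
Qed.
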